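(* Let $(X,d_X)$ and $(Y,d_Y)$ be polyhedral Hilbert geometries with $\dim X=\dim Y=n\geq 2$. If there exists an isometry $g\colon X\to Y$ (onto) whose induced map $\hat g$ on Busemann points maps vertex parts of $X$ to facet parts of $Y$, then $X$ and $Y$ are open $n$-simplices.
   Context: A polyhedral Hilbert geometry is a nonempty bounded set $X\subseteq\mathbb{R}^n$ which is the intersection of finitely many open half-spaces, with Hilbert metric $d_X(x,y)=\log\frac{|x'y|\,|y'x|}{|x'x|\,|y'y|}$ ($x',y'\in\partial X$ the endpoints of the chord through $x,y$, with $x',x,y,y'$ in order; $d_X(x,x)=0$). Horoboundary: fix a base-point $b\in X$; for $z\in X$ let $\phi_z(w)=d_X(w,z)-d_X(b,z)$; with the topology of uniform convergence on compacts, horofunctions are the limit points of $\{\phi_z\}$ not of the form $\phi_z$. A path $\gamma\colon T\to X$ ($T\subseteq\mathbb{R}$ unbounded, $0\in T$) is an almost-geodesic if for every $\epsilon>0$ there is $M$ with $|d(\gamma(t),\gamma(s))+d(\gamma(s),\gamma(0))-t|<\epsilon$ for all $t\geq s\geq M$ in $T$; Busemann points are horofunctions that are limits along almost-geodesics. Detour cost $H(\xi,\eta)=\inf_\gamma\liminf_{t\to\infty}(d(b,\gamma(t))+\eta(\gamma(t)))$ over paths $\gamma$ with $\phi_{\gamma(t)}\to\xi$; detour metric $\delta=H(\xi,\eta)+H(\eta,\xi)$; parts are the classes of Busemann points under $\delta(\xi,\eta)<\infty$. An isometry $g$ induces $\hat g(\xi)(y)=\xi(g^{-1}(y))-\xi(g^{-1}(b_Y))$,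 which maps parts onto parts. Description of parts: embed $X$ as $\{(x,1)\}\subseteq\mathbb{R}^{n+1}$, $C_X=\{\lambda(x,1)\colon\lambda>0,x\in X\}$. With $M(y/x;K)=\inf\{\lambda>0\colon\lambda x-y\in\overline K\}$, $\mathcal F_K(x,y)=\log M(x/y;K)$, $\mathcal{RF}_K(x,y)=\log M(y/x;K)$, $\tau(C,z)=\{\lambda(w-z)\colon\lambda>0,w\in C\}$, $\Gamma(\Pi)=\{\tau(T,z)\colon T\in\Pi,z\in\partial T\}$, $\mathcal T(C)=\bigcup_{k=1}^n\Gamma^k(\{C\})$, $f_{T,p}(w)=\mathcal F_T(w,p)-\mathcal F_T(b,p)$, $r_{C,z}(w)=\mathcal{RF}_C(w,z)-\mathcal{RF}_C(b,z)$: the Busemann points are the restrictions to $X$ of $r_{C_X,x}+f_{U,p}$ with $x\in\partial C_X\setminus\{0\}$, $U\in\mathcal T(\tau(C_X,x))$, $p\in U$, and the parts are the sets $P(F,U)=\{r_{C_X,x}+f_{U,p}\colon x\in F,p\in U\}$, $F$ the relative interior of a nonzero proper face of $\overline{C_X}$, $U\in\mathcal T(\tau(C_X,z))$, $z\in F$. A vertex part is $P(F,\tau(C_X,z))$ with $F$ the open ray through $(v,1)$, $v$ a vertex of $\overline X$; a facet part is $P(F,\tau(C_X,z))$ with $F$ the relative interior of an $n$-dimensional face of $\overline{C_X}$, $z\in F$. An open $n$-simplex is the interior of the convex hull of $n+1$ affinely independent points. *)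

(* Defs.v *)
From mathcomp Require Import all_boot all_order all_algebra.
From mathcomp Require Import all_classical all_reals all_analysis.
Set Implicit Arguments. Unset Strict Implicit. Unset Printing Implicit Defensive.
Import Order.TTheory GRing.Theory Num.Theory.
Import numFieldNormedType.Exports.
Local Open Scope classical_set_scope.
Local Open Scope ring_scope.

Section HilbertDefs.
Variable R : realType.

Definition dotv (m : nat) (a x : 'rV[R]_m) : R := \sum_(i < m) a 0 i * x 0 i.
Definition enorm (m : nat) (x : 'rV[R]_m) : R := Num.sqrt (dotv x x).

Definition polyhedral_hilbert (n : nat) (X : set 'rV[R]_n) : Prop :=
  [/\ exists s : seq ('rV[R]_n * R),
        (forall h, h \in s -> h.1 != 0) /\
        X = [set x | forall h, h \in s -> dotv h.1 x < h.2],
      X !=set0 &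
      exists M : R, forall x, X x -> enorm x <= M].

Definition chord_end (n : nat) (X : set 'rV[R]_n) (x y : 'rV[R]_n) : 'rV[R]_n :=
  x + sup [set s : R | 0 <= s /\ X (x + s *: (x - y))] *: (x - y).

Definition hdist (n : nat) (X : set 'rV[R]_n) (x y : 'rV[R]_n) : R :=
  if x == y then 0 else
  let x' := chord_end X x y in
  let y' := chord_end X y x in
  ln ((enorm (x' - y) * enorm (y' - x)) / (enorm (x' - x) * enorm (y' - y))).

Definition isometry_onto (n : nat) (X Y : set 'rV[R]_n) (g : 'rV[R]_n -> 'rV[R]_n) :=
  [/\ forall x, X x -> Y (g x),
      forall y, Y y -> exists2 x, X x & g x = y &
      forall x x', X x -> X x' -> hdist Y (g x) (g x') = hdist X x x'].

(** Functions on X are represented by functions on R^n vanishing off X. *)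
Definition restr (m : nat) (D : set 'rV[R]_m) (f : 'rV[R]_m -> R) : 'rV[R]_m -> R :=
  fun w => if `[< D w >] then f w else 0.

Definition ginv (n : nat) (X : set 'rV[R]_n) (g : 'rV[R]_n -> 'rV[R]_n) (y : 'rV[R]_n) :=
  xget 0 [set x | X x /\ g x = y].

Definition hatg (n : nat) (X Y : set 'rV[R]_n) (g : 'rV[R]_n -> 'rV[R]_n)
  (bY : 'rV[R]_n) (xi : 'rV[R]_n -> R) : 'rV[R]_n -> R :=
  restr Y (fun y => xi (ginv X g y) - xi (ginv X g bY)).

Definition emb (n : nat) (x : 'rV[R]_n) : 'rV[R]_(n + 1) := row_mx x (const_mx 1).
Definition coneX (n : nat) (X : set 'rV[R]_n) : set 'rV[R]_(n + 1) :=
  [set c | exists l x, [/\ 0 < l, X x & c = l *: emb x]].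

Definition tau (m : nat) (C : set 'rV[R]_m) (z : 'rV[R]_m) : set 'rV[R]_m :=
  [set c | exists l w, [/\ 0 < l, C w & c = l *: (w - z)]].

Definition Mrat (m : nat) (K : set 'rV[R]_m) (y x : 'rV[R]_m) : R :=
  inf [set l : R | 0 < l /\ closure K (l *: x - y)].
Definition Funk (m : nat) (K : set 'rV[R]_m) (x y : 'rV[R]_m) : R := ln (Mrat K x y).
Definition RFunk (m : nat) (K : set 'rV[R]_m) (x y : 'rV[R]_m) : R := ln (Mrat K y x).

Definition fTp (m : nat) (b : 'rV[R]_m) (T : set 'rV[R]_m) (p w : 'rV[R]_m) : R :=
  Funk T w p - Funk T b p.
Definition rCz (m : nat) (b : 'rV[R]_m) (C : set 'rV[R]_m) (z w : 'rV[R]_m) : R :=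
  RFunk C w z - RFunk C b z.

Definition busf (n : nat) (X : set 'rV[R]_n) (b : 'rV[R]_n)
  (x : 'rV[R]_(n + 1)) (U : set 'rV[R]_(n + 1)) (p : 'rV[R]_(n + 1)) : 'rV[R]_n -> R :=
  restr X (fun w => rCz (emb b) (coneX X) x (emb w) + fTp (emb b) U p (emb w)).

Definition partP (n : nat) (X : set 'rV[R]_n) (b : 'rV[R]_n)
  (F U : set 'rV[R]_(n + 1)) : set ('rV[R]_n -> R) :=
  [set xi | exists x p, [/\ F x, U p & xi = busf X b x U p]].

Definition is_face (m : nat) (K F : set 'rV[R]_m) : Prop :=
  [/\ F `<=` K,
      forall a c t, F a -> F c -> 0 <= t <= 1 -> F (t *: a + (1 - t) *: c) &
      forall a c t, K a -> K c -> 0 < t < 1 -> F (t *: a + (1 - t) *: c) -> F a /\ F c].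

Definition aff_indep (m k : nat) (p : 'I_k.+1 -> 'rV[R]_m) : bool :=
  row_free (\matrix_(i < k) (p (lift ord0 i) - p ord0)).

Definition affdim (m : nat) (F : set 'rV[R]_m) (d : nat) : Prop :=
  (exists p : 'I_d.+1 -> 'rV[R]_m, (forall i, F (p i)) /\ aff_indep p) /\
  ~ (exists p : 'I_d.+2 -> 'rV[R]_m, (forall i, F (p i)) /\ aff_indep p).

Definition aff_hull (m : nat) (F : set 'rV[R]_m) : set 'rV[R]_m :=
  [set y | exists k (c : 'I_k -> R) (q : 'I_k -> 'rV[R]_m),
     [/\ forall i, F (q i), \sum_(i < k) c i = 1 & y = \sum_(i < k) c i *: q i]].

Definition relint (m : nat) (F : set 'rV[R]_m) : set 'rV[R]_m :=
  [set x | F x /\ exists2 e : R, 0 < e &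
     forall y, aff_hull F y -> enorm (y - x) < e -> F y].

Definition oray (n : nat) (v : 'rV[R]_n) : set 'rV[R]_(n + 1) :=
  [set c | exists2 l : R, 0 < l & c = l *: emb v].

Definition vertex_part (n : nat) (X : set 'rV[R]_n) (b : 'rV[R]_n)
  (P : set ('rV[R]_n -> R)) : Prop :=
  exists v, is_face (closure X) [set v] /\
  exists2 z, oray v z & P = partP X b (oray v) (tau (coneX X) z).

Definition facet_part (n : nat) (X : set 'rV[R]_n) (b : 'rV[R]_n)
  (P : set ('rV[R]_n -> R)) : Prop :=
  exists G, [/\ is_face (closure (coneX X)) G, affdim G n &
  exists2 z, relint G z & P = partP X b (relint G) (tau (coneX X) z)].

Definition conv_hull (m k : nat) (p : 'I_k -> 'rV[R]_m) : set 'rV[R]_m :=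
  [set y | exists c : 'I_k -> R,
     [/\ forall i, 0 <= c i, \sum_(i < k) c i = 1 & y = \sum_(i < k) c i *: p i]].

Definition open_simplex (n : nat) (X : set 'rV[R]_n) : Prop :=
  exists2 p : 'I_n.+1 -> 'rV[R]_n, aff_indep p & X = interior (conv_hull p).

End HilbertDefs.

(* Main.v *)
Require Import Defs.
From mathcomp Require Import all_boot all_order all_algebra.
From mathcomp Require Import all_classical all_reals all_analysis.
From mathcomp Require Import lra ring.
Import Order.TTheory GRing.Theory Num.Theory.
Import numFieldNormedType.Exports.
Local Open Scope classical_set_scope.
Local Open Scope ring_scope.
Set Implicit Arguments. Unset Strict Implicit. Unset Printing Implicit Defensive.

(** Up to a constant, a Busemann function in the part of a vertex [v] is the logarithm of
    [q w = max_(f v = 0) (f w / f p) * max_f (f v / f w)], with [f] ranging over the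
    functionals defining the cone, and for a facet it has the same form with [v] replaced by
    a point [y] of the facet.  For [p = w], the line from [w] to [v] is the unique curve along
    which [ln q] decreases at unit speed.  Its image under the isometry has the same property
    in [Y], and this forces the line from [y] through [g w] to leave [Y] at a vertex.  Hence
    each point of [Y] lies between a vertex of [Y] and the facet associated with [v]; the
    vertex does not depend on the point, so [Y] is a pyramid over that facet with some apex
    [e v].  Distinct [v] give distinct apexes, so [e v'] lies in the facet of [v] whenever
    [v' <> v]: the apexes and the facet functionals are dual bases.  So [X] has at most
    [n + 1] vertices; as [X] is the hull of its vertices, it has exactly [n + 1], and both
    cones are simplicial. *)

(** * Dot products and step lengths *)

Section Dot.
Variables (R : realType) (m : nat).
Implicit Types (a c d : 'rV[R]_m).

Lemma dotvD a c d : dotv a (c + d) = dotv a c + dotv a d.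
Proof. by rewrite /dotv -big_split /=; apply: eq_bigr => i _; rewrite mxE mulrDr. Qed.

Lemma dotvZ a l c : dotv a (l *: c) = l * dotv a c.
Proof. by rewrite /dotv mulr_sumr; apply: eq_bigr => i _; rewrite mxE; ring. Qed.

Lemma dotvN a c : dotv a (- c) = - dotv a c.
Proof. by rewrite -scaleN1r dotvZ mulN1r. Qed.

Lemma dotvB a c d : dotv a (c - d) = dotv a c - dotv a d.
Proof. by rewrite dotvD dotvN. Qed.

Lemma dotv0 a : dotv a 0 = 0.
Proof. by rewrite -[0](scale0r (0 : 'rV[R]_m)) dotvZ mul0r. Qed.

Lemma dotv_sum a k (c : 'I_k -> R) (q : 'I_k -> 'rV[R]_m) :
  dotv a (\sum_i c i *: q i) = \sum_i c i * dotv a (q i).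
Proof.
elim/big_rec2: _ => [|i x y _ <-]; first exact: dotv0.
by rewrite dotvD dotvZ.
Qed.

End Dot.

Definition dotvE := (dotvD, dotvB, dotvZ, dotvN, dotv0).

(** Supplies the step length wherever a point is moved slightly under finitely many constraints. The
    default 1 of the minimum gives [t <= 1], and the [+ 1] keeps the denominators positive. *)
Lemma small_scale (R : realType) (N : nat) (s x : 'I_N -> R) :
  (forall i, 0 < s i) ->
  exists2 t : R, 0 < t <= 1 & forall i t', 0 <= t' <= t -> t' * `|x i| <= s i.
Proof.
move=> s0; pose t := \big[Order.min/1]_i (s i / (`|x i| + 1)).
have d0 i : 0 < `|x i| + 1 by have := normr_ge0 (x i); lra.
exists t => [|i t' /andP[t'0 t't]].
  apply/andP; split; last exact: bigmin_le_id.
  by apply: lt_bigmin => // i _; rewrite divr_gt0.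
have ti : t <= s i / (`|x i| + 1) by exact: bigmin_le.
have : t' <= s i / (`|x i| + 1) by lra.
rewrite ler_pdivlMr //; lra.
Qed.

(** * Polyhedral cones, extreme rays and steepest descent of [qf] *)

Section Cone.
Variables (R : realType) (m N : nat) (F : 'I_N -> 'rV[R]_m).
Implicit Types (a b c e p u v w x y : 'rV[R]_m) (P : pred 'I_N).
Local Notation f i c := (dotv (F i) c).

Definition ocone c := forall i, 0 < f i c.
Definition ccone c := forall i, 0 <= f i c.
Definition act c : pred 'I_N := fun i => f i c == 0.

Lemma ocone_ccone c : ocone c -> ccone c.
Proof. by move=> C i; apply: ltW. Qed.

Lemma ccone_nact c i : ccone c -> ~~ act c i -> 0 < f i c.
Proof. by move=> /(_ i) K nz; rewrite lt_neqAle eq_sym nz. Qed.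

(** The common zeros of the functionals active at [e] form the span of the smallest face containing
    [e]; the last clause says that this face is a ray. *)
Definition extray e := [/\ ccone e, e != 0 &
  forall c, (forall i, act e i -> f i c = 0) -> exists t, c = t *: e].

(* [M(a/b)] for the cone cut out by the functionals in [P], when [b] is in that cone. *)
Definition rmax P a b : R := \big[Order.max/0]_(i | P i) (f i a / f i b).

Lemma rmax_ge0 P a b : 0 <= rmax P a b.
Proof. exact: bigmax_ge_id. Qed.

Lemma rmax_ub P a b i : P i -> 0 < f i b -> f i a <= rmax P a b * f i b.
Proof.
move=> Pi b0; rewrite -ler_pdivrMr //.
exact: (le_bigmax_cond 0 (fun i => f i a / f i b)).
Qed.

Lemma rmax_lub P a b r : 0 <= r ->
  (forall i, P i -> 0 < f i b /\ f i a <= r * f i b) -> rmax P a b <= r.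
Proof.
move=> r0 H; apply: bigmax_le => // i Pi.
by have [b0 ab] := H i Pi; rewrite ler_pdivrMr.
Qed.

Lemma rmax_gt0 P a b i : P i -> 0 < f i a -> 0 < f i b -> 0 < rmax P a b.
Proof.
move=> Pi a0 b0; have := rmax_ub a Pi b0.
by move=> H; rewrite -(pmulr_lgt0 _ b0); apply: lt_le_trans H.
Qed.

Lemma rmax_attained P a b :
  0 < rmax P a b -> exists2 i, P i & rmax P a b = f i a / f i b.
Proof.
suff [-> |] : rmax P a b = 0 \/ exists2 i, P i & rmax P a b = f i a / f i b.
- by rewrite ltxx.
- by [].
apply: (big_ind (fun z => z = 0 \/ exists2 i, P i & z = f i a / f i b)).
- by left.
- by move=> x y Hx Hy; case: leP.
- by move=> i Pi; right; exists i.
Qed.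

Lemma rmaxZl P l a b : 0 <= l -> rmax P (l *: a) b = l * rmax P a b.
Proof.
move=> l0; rewrite /rmax (big_morph (fun z => l * z) (id1 := 0) (op1 := Order.max)).
- by apply: eq_bigr => i _; rewrite dotvZ mulrA.
- by move=> x y /=; rewrite maxr_pMr.
- by rewrite mulr0.
Qed.

Lemma rmaxZr P l a b : 0 < l -> rmax P a (l *: b) = l^-1 * rmax P a b.
Proof.
move=> l0; rewrite -rmaxZl ?invr_ge0 ?ltW //.
apply: eq_bigr => i _; rewrite !dotvZ invfM; ring.
Qed.

(* Up to a constant, the logarithm of [qf x p] is [r_{C,x} + f_{U,p}] with [U = tau C x],
   the cone cut out by the functionals vanishing at [x]. *)
Definition qf x p w := rmax (act x) w p * rmax predT x w.

Hypothesis pointed : forall c, (forall i, f i c = 0) -> c = 0.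

Lemma ccone_neq0 c : ccone c -> c != 0 -> exists i, 0 < f i c.
Proof.
move=> Kc /eqP c0; apply: contrapT => /forallNP H; apply: c0; apply: pointed => i.
by apply/eqP; rewrite eq_le Kc andbT leNgt; apply/negP/H.
Qed.

Lemma qf_gt0 x p w i : ccone x -> x != 0 -> act x i ->
  (forall i, act x i -> 0 < f i p) -> ocone w -> 0 < qf x p w.
Proof.
move=> Kx x0 xi pT Cw; have [j xj] := ccone_neq0 Kx x0.
by rewrite mulr_gt0 ?(rmax_gt0 xi) ?pT // (rmax_gt0 (i := j)).
Qed.

Lemma qfZ x p l w : 0 < l -> qf x p (l *: w) = qf x p w.
Proof.
move=> l0; rewrite /qf rmaxZl ?ltW // rmaxZr //.
by rewrite [X in X * _]mulrC -mulrA mulVKf ?gt_eqF.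
Qed.

(* Along the chord from [w] to the extreme ray [v] the function [qf v w] drops at unit
   speed, and only there. *)
Lemma steepest_direction v w w' i0 : extray v -> act v i0 -> ocone w -> ocone w' ->
  rmax predT w w' * rmax predT w' w * qf v w w' = qf v w w ->
  exists t, w' = (rmax predT w w')^-1 *: w + t *: v.
Proof.
move=> [Kv v0 kv] vi Cw Cw' E.
set a := rmax predT w w'; set c := rmax predT w' w; set A := rmax predT v w.
set r := rmax predT v w'; set k := rmax (act v) w' w.
have [j vj] := ccone_neq0 Kv v0.
have a0 : 0 < a by rewrite (rmax_gt0 (i := i0)).
have c0 : 0 < c by rewrite (rmax_gt0 (i := i0)).
have r0 : 0 < r by rewrite (rmax_gt0 (i := j)).
have one : rmax (act v) w w = 1.
  apply: le_anti; apply/andP; split.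
    by apply: rmax_lub => // i _; rewrite mul1r lexx.
  have := rmax_ub w vi (Cw i0).
  by rewrite -{1}[f i0 w]mul1r ler_pM2r.
(* Triangle inequality of the Funk metric in multiplicative form. *)
have Arc : A <= r * c.
  apply: rmax_lub => [|i _]; first by rewrite mulr_ge0 ?ltW.
  split=> //; apply: le_trans (rmax_ub v isT (Cw' i)) _.
  by rewrite -mulrA; apply: ler_wpM2l; [exact: ltW|exact: rmax_ub].
have ak : a * k <= 1.
  move: E; rewrite /qf one -/a -/c -/k -/r -/A mul1r => E.
  have rc : 0 < r * c by rewrite mulr_gt0.
  rewrite -(ler_pM2r rc) mul1r; apply: le_trans Arc.
  by rewrite -E le_eqVlt; apply/orP; left; apply/eqP; ring.
(* For [f i] vanishing at [v], the bounds [f i w <= a * f i w'] and [f i w' <= k * f i w] with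
   [a * k <= 1] force equality. *)
have kill i : act v i -> f i (w' - a^-1 *: w) = 0.
  move=> vi'; rewrite dotvB dotvZ; apply/eqP; rewrite subr_eq0 eq_le.
  have H1 : f i w' <= k * f i w by apply: rmax_ub.
  have H2 : f i w <= a * f i w' by apply: rmax_ub.
  have wi := Cw i.
  apply/andP; split.
    apply: le_trans H1 _; rewrite ler_pM2r // -[a^-1]mul1r ler_pdivlMr //.
    by rewrite mulrC.
  by rewrite ler_pdivrMl.
by have [t Et] := kv _ kill; exists t; rewrite -Et addrC subrK.
Qed.

(** Both points have the form [mu *: w + t *: v]. The product of the two maxima is then
    [1 + (t / mu) * A], so equal distances give equal ratios [t / mu], and the normalization by
    [f l] fixes [mu]. *)
Lemma steepest_unique v w w' w'' i0 l : extray v -> act v i0 ->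
  ocone w -> ocone w' -> ocone w'' ->
  0 < f l v -> f l w' = f l w -> f l w'' = f l w ->
  rmax predT w w' * rmax predT w' w = rmax predT w w'' * rmax predT w'' w ->
  rmax predT w w' * rmax predT w' w * qf v w w' = qf v w w ->
  rmax predT w w'' * rmax predT w'' w * qf v w w'' = qf v w w -> w' = w''.
Proof.
move=> ev vi Cw Cw' Cw'' lv lw' lw'' D E' E''.
have [Kv v0 _] := ev.
set A := rmax predT v w.
have A0 : 0 < A by rewrite (rmax_gt0 (i := l)).
have lw : 0 < f l w by [].
suff key z : ocone z -> f l z = f l w ->
    rmax predT w z * rmax predT z w * qf v w z = qf v w w ->
    exists mu t, [/\ z = mu *: w + t *: v, 0 < mu, t * f l v = (1 - mu) * f l w &
       rmax predT w z * rmax predT z w = mu^-1 * (mu + t * A)].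
  have [mu1 [t1 [z1 mu10 T1 D1]]] := key _ Cw' lw' E'.
  have [mu2 [t2 [z2 mu20 T2 D2]]] := key _ Cw'' lw'' E''.
  move: D; rewrite D1 D2 => D.
  have D' : t1 * mu2 = t2 * mu1.
    have e1 : mu1^-1 * (mu1 + t1 * A) = 1 + t1 / mu1 * A by field; rewrite gt_eqF.
    have e2 : mu2^-1 * (mu2 + t2 * A) = 1 + t2 / mu2 * A by field; rewrite gt_eqF.
    move: D; rewrite e1 e2 => /addrI /(mulIf (lt0r_neq0 A0)) /eqP.
    by rewrite eqr_div ?lt0r_neq0 // => /eqP.
  have Emu : mu1 = mu2.
    have : (mu1 - mu2) * f l w = 0.
      have : (t1 * mu2) * f l v = (t2 * mu1) * f l v by rewrite D'.
      rewrite [LHS]mulrAC [RHS]mulrAC T1 T2; nra.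
    by move/eqP; rewrite mulf_eq0 (gt_eqF lw) orbF subr_eq0 => /eqP.
  have Et : t1 = t2.
    by apply: (mulIf (lt0r_neq0 lv)); rewrite T1 T2 Emu.
  by rewrite z1 z2 Emu Et.
move=> Cz lz E; have [t zt] := steepest_direction ev vi Cw Cz E.
set mu := (rmax predT w z)^-1 in zt *.
have a0 : 0 < rmax predT w z by rewrite (rmax_gt0 (i := l)).
have mu0 : 0 < mu by rewrite invr_gt0.
have T : t * f l v = (1 - mu) * f l w.
  by have := lz; rewrite {1}zt !dotvE; lra.
have muw i : mu * f i w <= f i z by rewrite ler_pdivrMl // rmax_ub.
have t0 : 0 <= t.
  have : 0 <= t * f l v by have := muw l; rewrite lz; lra.
  by rewrite pmulr_lge0.
exists mu, t; split=> //; rewrite -[rmax predT w z]invrK -/mu; congr (_ * _).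
have nn : 0 <= mu + t * A by rewrite addr_ge0 ?mulr_ge0 // ltW.
apply: le_anti; apply/andP; split.
  apply: rmax_lub => // i _; split=> //; rewrite {1}zt !dotvE.
  have := rmax_ub v (isT : xpredT i) (Cw i); rewrite -/A => H.
  have := ler_wpM2l t0 H; lra.
have [i _ Ai] := rmax_attained A0.
have := rmax_ub z (isT : xpredT i) (Cw i).
rewrite {1}zt !dotvE.
have -> : mu * f i w + t * f i v = (mu + t * A) * f i w.
  by rewrite /A Ai; field; rewrite gt_eqF.
by rewrite ler_pM2r.
Qed.

(** The maxima are attained at functionals on which [e] vanishes; the other functionals have slack
    that absorbs a small [t *: e]. Thus a nonzero [e] would yield many points at distance
    [ln (1 + A)] from [u] with the same unit-speed drop of [ln qf]. *)
Lemma qf_perturb y p u e i0 (A := rmax predT y u) :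
  ccone y -> y != 0 -> act y i0 -> ocone u ->
  (forall i, act y i -> f i e = 0) ->
  (forall j, f j y = A * f j u -> f j e = 0) ->
  exists2 h : R, 0 < h & forall t, 0 <= t <= h ->
   let u' := u + y + t *: e in
   [/\ ocone u', rmax predT u u' = 1, rmax predT u' u = 1 + A &
       (1 + A) * qf y p u' = qf y p u].
Proof.
move=> Ky y0 yi Cu eI eJ.
have [j0 yj0] := ccone_neq0 Ky y0.
have A0 : 0 < A by rewrite (rmax_gt0 (i := j0)).
have yA j : f j y <= A * f j u by apply: rmax_ub.
pose d j := A * f j u - f j y.
(* The entries of the minimum are the slacks in the three inequalities of [bnd]; in the first case
   [f j e] is zero and 1 is arbitrary. *)
pose s j := if act y j || (d j == 0) then 1 else Order.min (f j y) (Order.min (d j) (d j / A)).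
have s0 j : 0 < s j.
  rewrite /s; case: ifP => // /norP[nj dj].
  have d0 : 0 < d j by rewrite lt_neqAle eq_sym dj /d subr_ge0 yA.
  by rewrite !lt_min d0 divr_gt0 // (ccone_nact Ky).
have [h /andP[h0 _] H] := small_scale (fun j => f j e) s0.
exists h => // t tI u'.
have fu' j : f j u' = f j u + f j y + t * f j e by rewrite /u' !dotvE.
have bnd j : [/\ f j u <= f j u', f j u' <= (1 + A) * f j u &
    (1 + A) * f j y <= A * f j u'].
  have := H j t tI; rewrite /s fu'.
  have [yj _|nj] := boolP (act y j).
    by have /eqP := yj; have := eI _ yj; have := Cu j; split; nra.
  have [/eqP|dj] := eqVneq (d j) 0; rewrite /= ?le_min.
    rewrite subr_eq0 => /eqP E; rewrite (eJ j) ?E //; have := Ky j; have := Cu j.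
    by split; nra.
  have /andP[t0 _] := tI.
  have -> : t * `|f j e| = `|t * f j e| by rewrite normrM (ger0_norm t0).
  rewrite ler_pdivlMr // !ler_norml => /and3P[/andP[b1 b2] /andP[b3 b4] b5].
  have := ler_norm (- (t * f j e)); rewrite normrN => b6.
  have b7 : - (t * f j e) * A <= `|t * f j e| * A by rewrite ler_wpM2r // ltW.
  have := Cu j; move: b1 b2 b3 b4 b5 b7; rewrite /d; split; nra.
have Cu' : ocone u' by move=> j; have [+ _ _] := bnd j; apply: lt_le_trans.
have fi i : act y i -> f i u' = f i u.
  by move=> yi'; rewrite fu' (eI _ yi') (eqP yi'); ring.
have [j _ Aj] := rmax_attained A0.
have yj : f j y = A * f j u by rewrite /A Aj divfK // gt_eqF.
split=> //.
- apply: le_anti; apply/andP; split.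
    by apply: rmax_lub => // k _; split=> //; rewrite mul1r; have [] := bnd k.
  have := rmax_ub u (isT : xpredT i0) (Cu' i0); rewrite fi // => H1.
  by rewrite -(ler_pM2r (Cu i0)) mul1r.
- apply: le_anti; apply/andP; split.
    apply: rmax_lub => [|k _]; first by rewrite addr_ge0 // ltW.
    by split=> //; have [] := bnd k.
  have := rmax_ub u' (isT : xpredT j) (Cu j); rewrite fu' (eJ _ yj) yj => H1.
  by rewrite -(ler_pM2r (Cu j)); lra.
- rewrite /qf; have -> : rmax predT y u' = A / (1 + A).
    apply: le_anti; apply/andP; split.
      apply: rmax_lub => [|k _]; first by rewrite divr_ge0 ?addr_ge0 // ltW.
      split=> //; have [_ _ b] := bnd k.
      by rewrite mulrAC ler_pdivlMr ?addr_gt0 // mulrC.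
    have := rmax_ub y (isT : xpredT j) (Cu' j); rewrite fu' (eJ _ yj) yj => H1.
    rewrite ler_pdivrMr ?addr_gt0 // -(ler_pM2r (Cu j)); lra.
  have -> : rmax (act y) u' p = rmax (act y) u p.
    by apply: eq_bigr => i yi'; rewrite fi.
  by rewrite -/A; field; rewrite gt_eqF // addr_gt0.
Qed.

(** The line from [y] through [u] leaves the cone at [u - A^-1 *: y], where the functionals
    attaining [A] vanish. A vector killed by all functionals active there, minus a multiple of this
    point, vanishes at [i0] too, hence on every functional active at [y]; by the last hypothesis it
    is zero. *)
Lemma extray_proj y u i0 (A := rmax predT y u) :
  ccone y -> y != 0 -> act y i0 -> ocone u ->
  (forall i, act y i -> exists k, forall c, f i c = k * f i0 c) ->
  (forall e, (forall i, act y i -> f i e = 0) ->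
    (forall j, f j y = A * f j u -> f j e = 0) -> e = 0) ->
  extray (u - A^-1 *: y).
Proof.
move=> Ky y0 yi Cu prop H.
have [j0 yj0] := ccone_neq0 Ky y0.
have A0 : 0 < A by rewrite (rmax_gt0 (i := j0)).
have fi : f i0 (u - A^-1 *: y) = f i0 u by rewrite !dotvE (eqP yi) mulr0 subr0.
split.
- move=> j; rewrite !dotvE subr_ge0 ler_pdivrMl //; exact: rmax_ub.
- by apply/eqP => E; have := Cu i0; rewrite -fi E dotv0 ltxx.
- move=> c kc; exists (f i0 c / f i0 u); apply/eqP; rewrite -subr_eq0; apply/eqP.
  have Z : f i0 (c - (f i0 c / f i0 u) *: (u - A^-1 *: y)) = 0.
    by rewrite dotvB dotvZ fi divfK ?subrr // gt_eqF.
  apply: H => [i yi'|j yj]; first by have [k ->] := prop i yi'; rewrite Z mulr0.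
  have aj : act (u - A^-1 *: y) j.
    by rewrite /act !dotvE yj mulKf ?lt0r_neq0 // subrr.
  by rewrite dotvB dotvZ kc // (eqP aj) mulr0 subr0.
Qed.

Lemma exists_small (a b : R) : 0 <= a -> 0 < b -> exists2 d : R, 0 < d <= 1 & d * a < b.
Proof.
move=> a0 b0; have s : 0 < a + b + 1 by lra.
exists (b / (a + b + 1)).
  by rewrite divr_gt0 //= ler_pdivrMr //; lra.
by rewrite mulrAC ltr_pdivrMr //; nra.
Qed.

Lemma extray_sym e1 e2 : extray e1 -> (exists t, e1 = t *: e2) -> exists t, e2 = t *: e1.
Proof.
move=> [_ n1 _] [t E]; exists t^-1; rewrite E scalerA mulVf ?scale1r //.
by apply/eqP => t0; move: n1; rewrite E t0 scale0r eqxx.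
Qed.

(* Two apexes [e1], [e2] cannot coexist: near [e1] every point of the cone lies over the
   apex [e1] only, and on the segment towards [e2] it would project beyond [e2]. *)
Lemma apex_unique k b e1 e2 : ocone b ->
  (forall u, ocone u -> exists e y,
     [/\ extray e, 0 < f k e, ccone y, f k y = 0 & u = e + y]) ->
  extray e1 -> extray e2 -> 0 < f k e1 -> 0 < f k e2 -> exists t, e2 = t *: e1.
Proof.
move=> Cb H E1 E2 p1 p2; apply: contrapT => ne.
have [K1 n1 k1] := E1; have [K2 n2 k2] := E2.
have [j a2 b1] : exists2 j, act e2 j & 0 < f j e1.
  apply: contrapT => /forall2NP no; apply: ne; apply: extray_sym => //; apply: k2.
  move=> i ai; apply/eqP; rewrite eq_le K1 andbT leNgt; apply/negP => pos.
  by case: (no i).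
pose c0 := f k e2 / f k e1.
have c00 : 0 < c0 by rewrite divr_gt0.
(* [q] will be an interior point so close to [e2] that [f j q < c0 * f j e1], while [f k q] exceeds
   [f k e2]. *)
have [eps /andP[eps0 _] Heps] := exists_small (ltW (Cb j)) (mulr_gt0 c00 b1).
have [q qE Cq] : exists2 q, q = e2 + eps *: b & ocone q.
  exists (e2 + eps *: b) => // i.
  by rewrite !dotvE; have := K2 i; have := mulr_gt0 eps0 (Cb i); lra.
(* An extreme ray is determined up to scaling by its active set, so one bound per set [S], and then
   the minimum over the finitely many [S], covers all rays. *)
have key (S : {set 'I_N}) : exists d : R, 0 < d <= 1 /\ forall d' e, 0 < d' <= d ->
    extray e -> act e =i S -> 0 < f k e -> f k e = f k (e1 + d' *: q) ->
    ccone (e1 + d' *: q - e) -> exists t, e = t *: e1.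
  have [[eS [ES aS pS nS]]|no] := pselect (exists eS,
      [/\ extray eS, act eS =i S, 0 < f k eS & ~ exists t, eS = t *: e1]).
    have [i ai bi] : exists2 i, act e1 i & 0 < f i eS.
      have [KS _ _] := ES.
      apply: contrapT => /forall2NP no; apply: nS; apply: k1.
      move=> i ai; apply/eqP; rewrite eq_le KS andbT leNgt; apply/negP => pos.
      by case: (no i).
    have [d d0 Hd] := exists_small (ltW (mulr_gt0 (Cq i) pS)) (mulr_gt0 p1 bi).
    exists d; split=> // d' e /andP[d'0 d'd] Ee ae pe ke Ke; exfalso.
    have [_ _ kS] := ES.
    have [t Et] : exists t, e = t *: eS.
      by apply: kS => l al; apply/eqP; have := ae l; rewrite -aS !unfold_in => ->.
    move: pe ke (Ke i); rewrite Et !dotvE (eqP ai) => pe ke Ki.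
    have t0 : 0 < t by rewrite -(pmulr_lgt0 _ pS).
    have m1 : f k e1 * f i eS <= t * f k eS * f i eS.
      by apply: ler_wpM2r; [exact: ltW|have := mulr_gt0 d'0 (Cq k); lra].
    have m2 : t * f i eS * f k eS <= d' * f i q * f k eS.
      by apply: ler_wpM2r; [exact: ltW|lra].
    have m3 : d' * (f i q * f k eS) <= d * (f i q * f k eS).
      by apply: ler_wpM2r => //; rewrite mulr_ge0 // ltW.
    lra.
  exists 1; split=> [|d' e _ Ee ae pe _ _]; first by rewrite ltr01 lexx.
  by apply: contrapT => ne1; apply: no; exists e.
have [dl Hdl] := choice key.
pose d := \big[Order.min/1]_S dl S.
have d0 : 0 < d by apply: lt_bigmin => // S _; have [/andP[]] := Hdl S.
have [e [y [Ee ek Ky yk E]]] : exists e y,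
    [/\ extray e, 0 < f k e, ccone y, f k y = 0 & e1 + d *: q = e + y].
  apply: H => i; rewrite !dotvE; have := K1 i; have := mulr_gt0 d0 (Cq i); lra.
have [t Et] : exists t, e = t *: e1.
  have [_ HS] := Hdl [set i | act e i]%SET.
  apply: (HS d e) => //.
  - by rewrite d0 /=; apply: bigmin_le.
  - by move=> i; rewrite inE.
  - by rewrite E dotvD yk addr0.
  - by rewrite E addrC addKr.
have yE : y = (1 - t) *: e1 + d *: q.
  by rewrite -[y](addKr e) -E Et scalerBl scale1r addrC addrAC.
(* [f k y = 0] forces [t] above 1 by at least [d * c0]. The term [d * f j q] is too small to offset
   [(1 - t) * f j e1], so [f j y] would be negative. *)
have := yk; have := Ky j; rewrite yE qE !dotvE (eqP a2) => H1 H2.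
have e2k : f k e2 = c0 * f k e1 by rewrite /c0 divfK // gt_eqF.
have bk := mulr_gt0 eps0 (Cb k).
have H3 : 1 - t <= - d * c0.
  rewrite -(ler_pM2r p1); rewrite e2k in H2.
  have := mulr_gt0 d0 bk; lra.
have H4 : (1 - t) * f j e1 <= - d * c0 * f j e1 by rewrite ler_wpM2r // ltW.
have : d * (eps * f j b) < d * (c0 * f j e1) by rewrite ltr_pM2l.
lra.
Qed.

End Cone.

(** * Generation of a cone by its extreme rays *)

Section Generation.
Variables (R : realType) (m N : nat) (F : 'I_N -> 'rV[R]_m).
Implicit Types (c d e : 'rV[R]_m).
Local Notation f i c := (dotv (F i) c).

(** Ratio test: the step is the smallest ratio over the functionals decreasing along [d]. The
    minimizing functional becomes active and the active ones stay so. *)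
Lemma exit_point c d i : ccone F c -> (forall i, act F c i -> f i d = 0) -> f i d < 0 ->
  exists t, [/\ 0 < t, ccone F (c + t *: d) &
    (#|[pred j | ~~ act F (c + t *: d) j]| < #|[pred j | ~~ act F c j]|)%N].
Proof.
move=> Kc kd di.
have pos j : f j d < 0 -> 0 < f j c.
  move=> dj; rewrite ccone_nact //; apply/negP => /kd E.
  by rewrite E ltxx in dj.
pose r j := f j c / - f j d.
have [j dj jmin] := @Order.TotalTheory.arg_minP _ _ _ i (fun j => f j d < 0) r di.
have Nj : 0 < - f j d by rewrite oppr_gt0.
have t0 : 0 < r j by rewrite divr_gt0 // pos.
have Kt : ccone F (c + r j *: d).
  move=> k; rewrite !dotvE; have [dk|dk] := ltP (f k d) 0.
    have := jmin k dk; rewrite {2}/r ler_pdivlMr ?oppr_gt0 //; lra.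
  by rewrite addr_ge0 // mulr_ge0 // ltW.
exists (r j); split=> //; apply: proper_card; apply/properP; split.
  apply/fintype.subsetP => k; rewrite !inE; apply: contraNN => ak.
  by rewrite /act !dotvE kd // (eqP ak) mulr0 addr0.
exists j; rewrite !inE; first by apply/negP => /kd E; rewrite E ltxx in dj.
rewrite negbK /act !dotvE /r; apply/eqP; field; by rewrite lt_eqF.
Qed.

(** Minkowski's theorem as an induction principle, proved by induction on the number of inactive
    functionals: a point not on an extreme ray lies between two exit points of a line, where more
    functionals are active. *)
Lemma ccone_ind (l : 'I_N) (P : 'rV[R]_m -> Prop) :
  (forall c, ccone F c -> f l c = 0 -> c = 0) ->
  P 0 -> (forall a c, P a -> P c -> P (a + c)) ->
  (forall t c, 0 <= t -> P c -> P (t *: c)) ->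
  (forall e, extray F e -> P e) -> forall c, ccone F c -> P c.
Proof.
move=> salient P0 PD PZ PE c.
have [k] := ubnP #|[pred j | ~~ act F c j]|; elim: k c => // k IH c.
rewrite ltnS => ck Kc.
have [-> //|c0] := eqVneq c 0.
have [|ne] := pselect (extray F c); first exact: PE.
have lc : 0 < f l c.
  rewrite lt_neqAle Kc andbT eq_sym; apply/eqP => E.
  by move/eqP: c0; apply; apply: salient.
have [d [kd nd]] : exists d, (forall i, act F c i -> f i d = 0) /\ ~ exists t, d = t *: c.
  apply: contrapT => /forallNP H; apply: ne; split=> // d kd.
  by apply: contrapT => nd; apply: (H d).
(* With [f l d' = 0], salience shows that neither [d'] nor [- d'] lies in the cone, so there is an
   exit in both directions. *)
pose d' := d - (f l d / f l c) *: c.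
have kd' i : act F c i -> f i d' = 0.
  by move=> ai; rewrite !dotvE kd // (eqP ai) mulr0 subr0.
have ld' : f l d' = 0 by rewrite !dotvE divfK ?subrr // gt_eqF.
have nd' : d' <> 0 by move/eqP; rewrite subr_eq0 => /eqP E; apply: nd; eexists; exact: E.
clearbody d'.
have neg s : s != 0 -> exists i, f i (s *: d') < 0.
  move=> s0; apply: contrapT => /forallNP H; apply: nd'.
  have : s *: d' = 0.
    apply: salient => [i|]; last by rewrite dotvZ ld' mulr0.
    by rewrite leNgt; apply/negP/H.
  by move/eqP; rewrite scaler_eq0 (negbTE s0) => /eqP.
have step s : s != 0 -> exists2 t, 0 < t & P (c + t *: (s *: d')).
  move=> s0; have [i di] := neg s s0.
  have [|t [t0 Kt lt]] := exit_point Kc _ di.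
    by move=> j aj; rewrite dotvZ kd' // mulr0.
  by exists t => //; apply: IH Kt; apply: leq_trans lt ck.
have [t1 t10 P1] := step 1 (oner_neq0 _).
have [|t2 t20 P2] := step (-1); first by rewrite oppr_eq0 oner_neq0.
have t12 : 0 < t1 + t2 by rewrite addr_gt0.
have ab1 : t2 / (t1 + t2) + t1 / (t1 + t2) = 1 by field; rewrite gt_eqF.
have ab2 : t2 / (t1 + t2) * t1 = t1 / (t1 + t2) * t2 by ring.
have a0 : 0 <= t2 / (t1 + t2) by rewrite divr_ge0 // ltW.
have b0 : 0 <= t1 / (t1 + t2) by rewrite divr_ge0 // ltW.
move: (t2 / _) (t1 / _) ab1 ab2 a0 b0 => a b ab1 ab2 a0 b0.
have -> : c = a *: (c + t1 *: (1 *: d')) + b *: (c + t2 *: (-1 *: d')).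
  rewrite scale1r scaleN1r !scalerDr scalerN scalerN !scalerA ab2 addrACA subrr.
  by rewrite addr0 -scalerDl ab1 scale1r.
by apply: PD; apply: PZ.
Qed.

End Generation.

(** * Closures of sets given by strict inequalities *)

Section Topology.
Variables (R : realType) (m : nat).
Implicit Types (x d y : 'rV[R]_m).

Lemma dotv_continuous (a : 'rV[R]_m) : continuous (dotv a).
Proof.
rewrite /dotv => x; have Fx := nbhs_filter x.
apply: cvg_big; first exact: add_continuous.
move=> i _; apply: cvgM; first exact: cvg_cst.
exact: coord_continuous.
Qed.

Lemma segment_nbhs x d (B : set 'rV[R]_m) : nbhs x B ->
  exists2 e : R, 0 < e & forall t, `|t| < e -> B (x + t *: d).
Proof.
move=> Bx; have : (x + t *: d) @[t --> (0 : R)] --> x.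
  rewrite -[X in _ --> X]addr0 -(scale0r d).
  apply: cvgD; first exact: cvg_cst.
  by apply: cvgZr_tmp; exact: cvg_id.
move=> /(_ _ Bx) /nbhs_ballP [e e0 H]; exists e => // t te.
by apply: H; rewrite -ball_normE /= sub0r normrN.
Qed.

(** A point with weak inequalities is a limit of points moved towards [y], where all are strict.
    Stating affinity along such segments covers both the linear functionals on the cone and their
    affine restrictions to [X]. *)
Lemma closure_pos N (P : pred 'I_N) (g : 'I_N -> 'rV[R]_m -> R) y :
  (forall i, continuous (g i)) ->
  (forall i x t, g i (x + t *: (y - x)) = g i x + t * (g i y - g i x)) ->
  (forall i, P i -> 0 < g i y) ->
  closure [set x | forall i, P i -> 0 < g i x] = [set x | forall i, P i -> 0 <= g i x].
Proof.
move=> gc ga gy; apply/seteqP; split => x /= Hx.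
  move=> i Pi; rewrite leNgt; apply/negP => gx.
  have : nbhs x (g i @^-1` [set z | z < 0]) by apply: gc; exact: lt_nbhsl.
  by move=> /Hx [z /= [/(_ i Pi) z0 z1]]; have := lt_trans z0 z1; rewrite ltxx.
move=> B /(segment_nbhs (y - x)) [e e0 H].
pose t := Num.min (e / 2) 1.
have t0 : 0 < t by rewrite lt_min ltr01 divr_gt0.
have t1 : t <= 1 by rewrite ge_min lexx orbT.
have te : t <= e / 2 by rewrite ge_min lexx.
exists (x + t *: (y - x)); split => /= [i Pi|].
  rewrite ga; have gy1 := mulr_gt0 t0 (gy i Pi).
  have : 0 <= (1 - t) * g i x by rewrite mulr_ge0 ?subr_ge0 ?Hx.
  lra.
by apply: H; rewrite gtr0_norm //; lra.
Qed.

End Topology.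

(** * Homogenization of [X] *)

Section Emb.
Variables (R : realType) (n : nat).
Implicit Types (x y : 'rV[R]_n) (c : 'rV[R]_(n + 1)).

Definition height c : R := c 0 (rshift n ord0).
Definition dehom c : 'rV[R]_n := (height c)^-1 *: lsubmx c.

Lemma dotv_row_mx (a x : 'rV[R]_n) (b z : 'rV[R]_1) :
  dotv (row_mx a b) (row_mx x z) = dotv a x + b 0 0 * z 0 0.
Proof.
rewrite /dotv big_split_ord /= big_ord1; congr (_ + _).
  by apply: eq_bigr => i _; rewrite !row_mxEl.
by rewrite !row_mxEr.
Qed.

Lemma height_emb x : height (emb x) = 1.
Proof. by rewrite /height /emb row_mxEr mxE. Qed.

Lemma dehom_emb c : height c != 0 -> emb (dehom c) = (height c)^-1 *: c.
Proof.
move=> h0; have -> : (height c)^-1 *: c =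
    row_mx ((height c)^-1 *: lsubmx c) ((height c)^-1 *: rsubmx c).
  by rewrite -scale_row_mx hsubmxK.
rewrite /emb /dehom; congr row_mx.
apply/rowP => i; rewrite (ord1 i) !mxE mulrC.
by rewrite (_ : c _ _ = height c) ?mulfV // /height; congr (c _ _); exact: val_inj.
Qed.

Lemma embB x y : emb x - emb y = row_mx (x - y) 0.
Proof. by rewrite /emb opp_row_mx add_row_mx subrr. Qed.

Lemma emb_inj : injective (@emb R n).
Proof. by move=> x y /eq_row_mx []. Qed.

Lemma emb_line x y z t : emb (x + t *: (y - z)) = emb x + t *: (emb y - emb z).
Proof. by rewrite embB /emb scale_row_mx add_row_mx scaler0 addr0. Qed.

Lemma dotv_emb_continuous (a : 'rV[R]_(n + 1)) : continuous (fun x => dotv a (emb x)).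
Proof.
have -> : (fun x => dotv a (emb x)) = fun x => dotv (lsubmx a) x + rsubmx a 0 0 * 1.
  by apply/funext => x; rewrite -[a in LHS]hsubmxK dotv_row_mx [const_mx 1 _ _]mxE.
move=> x; apply: continuousD; last exact: cst_continuous.
exact: dotv_continuous.
Qed.

Lemma enormZ (x : 'rV[R]_n) t : enorm (t *: x) = `|t| * enorm x.
Proof.
rewrite /enorm dotvZ.
have -> : dotv (t *: x) x = t * dotv x x.
  by rewrite /dotv mulr_sumr; apply: eq_bigr => i _; rewrite mxE; ring.
by rewrite mulrA -expr2 sqrtrM ?sqr_ge0 // sqrtr_sqr.
Qed.

Lemma dotv_ge0 (x : 'rV[R]_n) : 0 <= dotv x x.
Proof. by apply: sumr_ge0 => i _; rewrite -expr2 sqr_ge0. Qed.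

Lemma coord_enorm (x : 'rV[R]_n) i : `|x 0 i| <= enorm x.
Proof.
rewrite -sqrtr_sqr ler_sqrt ?dotv_ge0 // /dotv (bigD1 i) //= expr2 lerDl.
by apply: sumr_ge0 => j _; rewrite -expr2 sqr_ge0.
Qed.

Lemma enorm_gt0 (x : 'rV[R]_n) : x != 0 -> 0 < enorm x.
Proof.
move=> /eqP x0; rewrite lt_neqAle sqrtr_ge0 andbT; apply/eqP => E; apply: x0.
by apply/rowP => i; rewrite mxE; have := coord_enorm x i; rewrite -E normr_le0 => /eqP.
Qed.

(* The height is required to be one of the functionals, so that they cut out the cone over
   [X] without a separate positivity condition on the last coordinate. *)
Definition cone_rep (X : set 'rV[R]_n) N (F : 'I_N -> 'rV[R]_(n + 1)) (l : 'I_N) :=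
  [/\ forall x, X x <-> ocone F (emb x),
      forall c, dotv (F l) c = height c,
      forall c, ccone F c -> height c = 0 -> c = 0 &
      X !=set0].

(** A half-space [dotv a x < b] becomes the functional [(- a, b)], and index [ord0] is the height.
    Boundedness gives salience: a nonzero cone vector of height 0 would be the direction of a ray
    inside [X]. *)
Lemma polyhedral_cone_rep X : polyhedral_hilbert X ->
  exists N (F : 'I_N -> 'rV[R]_(n + 1)) l, cone_rep X F l.
Proof.
move=> [[s [_ XE]] Xne [M XM]].
pose h0 : 'rV[R]_n * R := (0, 0).
pose F (i : 'I_(size s).+1) : 'rV[R]_(n + 1) :=
  if unlift ord0 i is Some j then row_mx (- (nth h0 s j).1) (const_mx (nth h0 s j).2)
  else row_mx 0 (const_mx 1).
have Fl c : dotv (F ord0) c = height c.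
  rewrite -[c]hsubmxK /F unlift_none dotv_row_mx [const_mx 1 _ _]mxE.
  by rewrite /dotv big1 ?add0r ?mul1r /height ?row_mxEr // => i _; rewrite mxE mul0r.
have FE j x z : dotv (F (lift ord0 j)) (row_mx x (const_mx z)) =
    (nth h0 s j).2 * z - dotv (nth h0 s j).1 x.
  rewrite /F liftK dotv_row_mx !mxE addrC; congr (_ + _).
  by rewrite /dotv -sumrN; apply: eq_bigr => i _; rewrite mxE mulNr.
have XF x : X x <-> ocone F (emb x).
  rewrite XE; split=> [H i|H h hs] /=.
    case: (unliftP ord0 i) => [j|] ->; last by rewrite Fl height_emb.
    by rewrite /emb FE mulr1 subr_gt0 H // mem_nth.
  have hi : (index h s < size s)%N by rewrite index_mem.
  have := H (lift ord0 (Ordinal hi)).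
  by rewrite /emb FE mulr1 subr_gt0 nth_index.
exists (size s).+1, F, ord0; split=> // c Kc hc.
have [x Xx] := Xne.
have cE : c = row_mx (lsubmx c) 0.
  rewrite -[c in LHS]hsubmxK; congr row_mx; apply/rowP => i; rewrite (ord1 i) !mxE.
  by rewrite -hc /height; congr (c _ _); exact: val_inj.
move: (lsubmx c) cE => d cE; suff d0 : d = 0 by rewrite cE d0 row_mx0.
apply/rowP => i; rewrite [RHS]mxE; apply: contrapT => /eqP di.
(* Chosen so that coordinate [i] of [x + t *: d] is at least [M + 1] in absolute value. *)
pose t := (M + `|x 0 i| + 1) / `|d 0 i|.
have M0 : 0 <= M by apply: le_trans (XM _ Xx); exact: sqrtr_ge0.
have di0 : 0 < `|d 0 i| by rewrite normr_gt0.
have t0 : 0 <= t by rewrite divr_ge0 // ?addr_ge0.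
have : X (x + t *: d).
  apply/XF => k; have -> : emb (x + t *: d) = emb x + t *: c.
    by rewrite cE /emb scale_row_mx add_row_mx scaler0 addr0.
  have Fx := proj1 (XF x) Xx k; have := mulr_ge0 t0 (Kc k).
  by rewrite !dotvE; lra.
move=> /XM /(le_trans (coord_enorm _ i)); rewrite !mxE => H.
have H1 : `|t * d 0 i| = M + `|x 0 i| + 1.
  by rewrite normrM (ger0_norm t0) /t divfK // gt_eqF.
have := ler_normB (x 0 i + t * d 0 i) (x 0 i).
have -> : x 0 i + t * d 0 i - x 0 i = t * d 0 i by ring.
rewrite H1; lra.
Qed.

End Emb.

(** * Tangent cones, Busemann functions and the metric through functionals *)

Section Geometry.
Variables (R : realType) (n N : nat) (X : set 'rV[R]_n).
Variables (F : 'I_N -> 'rV[R]_(n + 1)) (l : 'I_N).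
Implicit Types (x y : 'rV[R]_n) (c z p : 'rV[R]_(n + 1)).
Local Notation f i c := (dotv (F i) c).
Hypothesis rep : cone_rep X F l.

Lemma repP x : X x <-> ocone F (emb x). Proof. by have [] := rep. Qed.

Lemma repl c : f l c = height c. Proof. by have [] := rep. Qed.

Lemma salient c : ccone F c -> height c = 0 -> c = 0.
Proof. by have [_ _ + _] := rep; apply. Qed.

Lemma rep_pointed c : (forall i, f i c = 0) -> c = 0.
Proof.
by move=> c0; apply: salient => [i|]; rewrite -?repl c0.
Qed.

Lemma repfl x : f l (emb x) = 1. Proof. by rewrite repl height_emb. Qed.

Lemma dehom_ocone c : ocone F c -> X (dehom c) /\ emb (dehom c) = (height c)^-1 *: c.
Proof.
move=> Cc; have h0 : 0 < height c by rewrite -repl.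
have E := dehom_emb (lt0r_neq0 h0); split=> //.
by apply/repP => i; rewrite E dotvZ mulr_gt0 ?invr_gt0.
Qed.

Lemma coneXE : coneX X = [set c | ocone F c].
Proof.
apply/seteqP; split=> c /=.
  by move=> [t [x [t0 /repP Cx ->]]] i; rewrite dotvZ mulr_gt0.
move=> Cc; have [Xp E] := dehom_ocone Cc.
have h0 : 0 < height c by rewrite -repl.
by exists (height c), (dehom c); rewrite E scalerA mulfV ?scale1r // gt_eqF.
Qed.

Lemma closure_cone (P : pred 'I_N) z : (forall i, P i -> 0 < f i z) ->
  closure [set c | forall i, P i -> 0 < f i c] = [set c | forall i, P i -> 0 <= f i c].
Proof.
move=> Pz; apply: (closure_pos (y := z) (g := fun i => dotv (F i))) => //.
  by move=> i; apply: dotv_continuous.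
by move=> i x t; rewrite !dotvE.
Qed.

Lemma closure_coneX : closure (coneX X) = [set c | ccone F c].
Proof.
have [_ _ _ [x /repP Cx]] := rep.
have := @closure_cone predT _ (fun i _ => Cx i); rewrite coneXE => E.
have -> : [set c | ocone F c] = [set c | forall i, predT i -> 0 < f i c].
  by apply/seteqP; split=> c /= H i => [_|]; apply: H.
by rewrite E; apply/seteqP; split=> c /= H i => [|_]; apply: H.
Qed.

Lemma closureX : closure X = [set x | ccone F (emb x)].
Proof.
have [_ _ _ [x /repP Cx]] := rep.
pose g i y := f i (emb y).
have gc i : continuous (g i) by exact: dotv_emb_continuous.
have := @closure_pos _ _ _ predT g x gc _ (fun i _ => Cx i).
have -> : [set y | forall i, predT i -> 0 < g i y] = X.
  by apply/seteqP; split=> y /= H; [apply/repP => i; apply: H|move=> i _; exact: (proj1 (repP y) H)].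
move=> ->; last by move=> i y t; rewrite /g emb_line !dotvE.
by apply/seteqP; split=> y /= H i => [|_]; apply: H.
Qed.

Lemma inf_ge (r : R) : 0 <= r -> inf [set t | 0 < t /\ r <= t] = r.
Proof.
move=> r0; apply: le_anti; apply/andP; split.
  apply/ler_addgt0Pr => e e0; apply: ge_inf; last by split; lra.
  by exists 0 => t [t0 _]; apply: ltW.
apply: lb_le_inf; first by exists (r + 1); split; lra.
by move=> t [].
Qed.

(** The value 0 at which [rmax] starts accounts for the infimum being over positive scalars. *)
Lemma MratE (P : pred 'I_N) c z : (forall i, P i -> 0 < f i z) ->
  Mrat [set d | forall i, P i -> 0 < f i d] c z = rmax F P c z.
Proof.
move=> Pz; rewrite /Mrat (closure_cone Pz) -[RHS]inf_ge ?rmax_ge0 //.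
congr (inf _); apply/seteqP; split=> t /= [t0 H]; split=> //.
  apply: rmax_lub => [|i Pi]; first exact: ltW.
  by split; [exact: Pz|have := H i Pi; rewrite !dotvE subr_ge0].
move=> i Pi; rewrite !dotvE subr_ge0.
by apply: le_trans (rmax_ub c Pi (Pz i Pi)) _; rewrite ler_wpM2r // ltW ?Pz.
Qed.

(** Near [z] only the functionals vanishing at [z] constrain the cone: if they are positive at [c],
    then [z + t *: c] is inside for small [t]. *)
Lemma tauE z : ccone F z ->
  tau (coneX X) z = [set c | forall i, act F z i -> 0 < f i c].
Proof.
move=> Kz; rewrite coneXE; apply/seteqP; split=> c /=.
  move=> [t [w [t0 Cw ->]]] i /eqP zi.
  by rewrite dotvZ dotvB zi subr0 mulr_gt0.
move=> Hc; have [] := @small_scale R N (fun i => if act F z i then 1 else f i z / 2) (fun i => f i c).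
  by move=> i; case: ifPn => // nz; rewrite divr_gt0 // (ccone_nact Kz).
move=> t /andP[t0 t1] Ht.
exists t^-1, (z + t *: c); split; first by rewrite invr_gt0.
  move=> i; rewrite !dotvE; have := Ht i t; rewrite lexx ltW // => /(_ isT).
  case: ifPn => [zi _|nz H].
    by rewrite (eqP zi) add0r mulr_gt0 // Hc.
  have := ccone_nact Kz nz; have := ler_norm (- f i c); rewrite normrN => h1 h2.
  have := ler_wpM2l (ltW t0) h1; lra.
by rewrite addrC addKr scalerA mulVf ?scale1r // gt_eqF.
Qed.

(** A part fixes one [z] for the tangent cone while [x] varies over the face; [tau] depends on [z]
    only through its active functionals. *)
Lemma busfE b (x z p : 'rV[R]_(n + 1)) i0 : X b -> ccone F x -> x != 0 -> act F x i0 ->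
  ccone F z -> act F z =1 act F x -> tau (coneX X) z p ->
  busf X b x (tau (coneX X) z) p =
  restr X (fun w => ln (qf F x p (emb w)) - ln (qf F x p (emb b))).
Proof.
move=> Xb Kx x0 xi Kz zx; rewrite tauE // => /= pz.
have px i : act F x i -> 0 < f i p by rewrite -zx => /pz.
have lnq (w : 'rV[R]_(n + 1)) : ocone F w -> ln (qf F x p w) = ln (rmax F (act F x) w p) + ln (rmax F predT x w).
  move=> Cw; have [j xj] := ccone_neq0 rep_pointed Kx x0.
  have wp : 0 < rmax F (act F x) w p by apply: (rmax_gt0 xi) => //; exact: px.
  by rewrite lnM // posrE; apply: (rmax_gt0 (i := j)).
have Mz w : Mrat [set c | forall i, act F z i -> 0 < f i c] w p = rmax F (act F x) w p.
  by rewrite MratE //; apply: eq_bigl.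
have MC (w : 'rV[R]_(n + 1)) : ocone F w -> Mrat (coneX X) x w = rmax F predT x w.
  move=> Cw; rewrite -(@MratE predT x w) // coneXE; congr Mrat.
  by apply/seteqP; split=> c /= H i => [_|]; apply: H.
rewrite /busf /restr; apply/funext => w; case: ifPn => // /asboolP Xw.
have Cw := proj1 (repP w) Xw; have Cb := proj1 (repP b) Xb.
rewrite /rCz /fTp /RFunk /Funk !Mz !MC // !lnq //; ring.
Qed.

(** Otherwise [emb x - emb y] would be a cone vector of height 0, hence zero. *)
Lemma rmax_gt1 x y : X x -> X y -> x != y -> 1 < rmax F predT (emb y) (emb x).
Proof.
move=> Xx Xy xy; rewrite ltNge; apply/negP => r1; move/eqP: xy; apply.
apply: emb_inj; apply/eqP; rewrite -subr_eq0; apply/eqP; apply: salient => [i|].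
  rewrite dotvB subr_ge0.
  have Cx := proj1 (repP x) Xx.
  apply: le_trans (rmax_ub (emb y) (isT : xpredT i) (Cx i)) _.
  by rewrite -[leRHS]mul1r ler_wpM2r // ltW.
by rewrite -repl dotvB !repfl subrr.
Qed.

(** With [r] the maximal ratio, at parameter [s] each functional is at least [1 - s * (r - 1)] times
    its value at [x], with equality where [r] is attained. *)
Lemma chord_endE x y : X x -> X y -> x != y ->
  chord_end X x y = x + (rmax F predT (emb y) (emb x) - 1)^-1 *: (x - y).
Proof.
move=> Xx Xy xy; rewrite /chord_end; congr (_ + _ *: _).
have Cx := proj1 (repP x) Xx.
have r1 := rmax_gt1 Xx Xy xy.
have [|i _ ri] := @rmax_attained _ _ _ F predT (emb y) (emb x); first by lra.
have ub k : f k (emb y) <= rmax F predT (emb y) (emb x) * f k (emb x).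
  exact: rmax_ub.
move: (rmax _ _ _ _) ub r1 ri => r ub r1 ri.
set A := [set s | _]; set S := (r - 1)^-1.
have r10 : 0 < r - 1 by lra.
have S0 : 0 < S by rewrite invr_gt0.
have memA s : 0 <= s -> s < S -> A s.
  move=> s0 sS; split=> //; apply/repP => j; rewrite emb_line !dotvE.
  have : s * (r - 1) < 1 by rewrite -ltr_pdivlMr // mul1r.
  have := ub j; have := Cx j; set a := f j (emb x); set d := f j (emb y) => a0 H H2.
  have := ler_wpM2l s0 H; have : s * (r - 1) * a < 1 * a by rewrite ltr_pM2r.
  lra.
have ubA : ubound A S.
  move=> s [s0 /repP /(_ i)]; rewrite emb_line !dotvE => H.
  rewrite -[S]mul1r ler_pdivlMr //.
  have E : f i (emb y) = r * f i (emb x) by rewrite ri divfK // gt_eqF.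
  move: H; rewrite E => H; have a0 := Cx i.
  by rewrite -(ler_pM2r a0); lra.
have A0 : A 0 by apply: memA.
apply: le_anti; apply/andP; split.
  by apply: ge_sup => //; exists 0.
rewrite leNgt; apply/negP => lt.
have s0 : 0 <= sup A by apply: ub_le_sup => //; exists S.
have : (sup A + S) / 2 <= sup A by apply: ub_le_sup; [exists S|apply: memA; lra].
lra.
Qed.

(** The four norms are multiples of [enorm (x - y)], and each chord end contributes
    [(1 + S) / S = r] with [S = (r - 1)^-1]. *)
Lemma hdistE x y : X x -> X y -> hdist X x y =
  ln (rmax F predT (emb x) (emb y) * rmax F predT (emb y) (emb x)).
Proof.
move=> Xx Xy; rewrite /hdist; case: ifPn => [/eqP <-|xy].
  have -> : rmax F predT (emb x) (emb x) = 1.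
    have Cx := proj1 (repP x) Xx.
    apply: le_anti; apply/andP; split.
      by apply: rmax_lub => // i _; rewrite mul1r lexx.
    by have := rmax_ub (emb x) (isT : xpredT l) (Cx l); rewrite repfl mulr1.
  by rewrite mulr1 ln1.
have yx : y != x by rewrite eq_sym.
have r1 := rmax_gt1 Xx Xy xy; have r2 := rmax_gt1 Xy Xx yx.
congr ln; rewrite (chord_endE Xx Xy xy) (chord_endE Xy Xx yx).
move: (rmax _ _ (emb y) _) (rmax _ _ (emb x) _) r1 r2 => r r' r1 r2.
have E (u v : 'rV[R]_n) t : u + t *: (u - v) - v = (1 + t) *: (u - v).
  by rewrite addrAC scalerDl scale1r.
have E' (u v : 'rV[R]_n) t : u + t *: (u - v) - u = t *: (u - v).
  by rewrite addrC addKr.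
rewrite !E !E' !enormZ.
have S0 : 0 < (r - 1)^-1 by rewrite invr_gt0; lra.
have S0' : 0 < (r' - 1)^-1 by rewrite invr_gt0; lra.
have e0 : 0 < enorm (x - y) by rewrite enorm_gt0 // subr_eq0.
have e0' : 0 < enorm (y - x) by rewrite enorm_gt0 // subr_eq0.
rewrite !gtr0_norm ?addr_gt0 //; field.
by rewrite !gt_eqF ?subr_gt0 //= ; lra.
Qed.

End Geometry.

(** * Vertices, faces and their active functionals *)

Section Faces.
Variables (R : realType) (n N : nat) (X : set 'rV[R]_n).
Variables (F : 'I_N -> 'rV[R]_(n + 1)) (l : 'I_N).
Implicit Types (x y v : 'rV[R]_n) (a c e q z p : 'rV[R]_(n + 1)).
Local Notation f i c := (dotv (F i) c).
Hypothesis rep : cone_rep X F l.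

(** A vector killed by the functionals active at [emb v] has, after removal of its height, a
    horizontal part [d]; then [v] is the midpoint of [v + t *: d] and [v - t *: d] in the closure,
    so [d] is zero. *)
Lemma vertex_extray v : is_face (closure X) [set v] -> extray F (emb v).
Proof.
rewrite (closureX rep) => -[+ _ ext]; move/(_ v erefl) => /= Kv; split=> //.
  by apply/eqP => E; have := repfl rep v; rewrite E dotv0 => /esym/eqP; rewrite oner_eq0.
move=> c kc; exists (height c).
have kd i : act F (emb v) i -> f i (c - height c *: emb v) = 0.
  by move=> vi; rewrite dotvB dotvZ kc // (eqP vi) mulr0 subr0.
set d := lsubmx (c - height c *: emb v).
have dE : c - height c *: emb v = row_mx d 0.
  rewrite -[LHS]hsubmxK -/d; congr row_mx; apply/rowP => i; rewrite (ord1 i) [RHS]mxE mxE.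
  by rewrite -[LHS]/(height _) -(repl rep) dotvB dotvZ (repfl rep) mulr1 (repl rep) subrr.
have [] := @small_scale R N (fun i => if act F (emb v) i then 1 else f i (emb v))
    (fun i => f i (row_mx d 0)).
  by move=> i; case: ifPn => // nz; rewrite (ccone_nact Kv).
move=> t /andP[t0 t1] Ht.
have Kt s : `|s| <= t -> ccone F (emb (v + s *: d)).
  move=> st i; have -> : emb (v + s *: d) = emb v + s *: row_mx d 0.
    by rewrite /emb scale_row_mx add_row_mx scaler0 addr0.
  have := Ht i `|s|; rewrite normr_ge0 st => /(_ isT).
  rewrite !dotvE; case: ifPn => [vi _|_].
    by rewrite -dE kd // (eqP vi) mulr0 addr0.
  by rewrite -normrM ler_norml => /andP[h1 h2]; lra.
have [||//||] := ext (v + t *: d) (v + (- t) *: d) (1 / 2).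
- by apply: Kt; rewrite gtr0_norm.
- by apply: Kt; rewrite normrN gtr0_norm.
- by apply/andP; split; lra.
- by apply/rowP => k; rewrite mxE !scalerDr !mxE; lra.
move=> /= E _; have d0 : d = 0.
  apply/eqP; have : t *: d = 0 by rewrite -[LHS](addKr v) E addNr.
  by move/eqP; rewrite scaler_eq0 gt_eqF.
by apply/eqP; rewrite -subr_eq0 dE d0 row_mx0.
Qed.

Lemma extray_vertex e : extray F e ->
  [/\ 0 < height e, e = height e *: emb (dehom e) & is_face (closure X) [set dehom e]].
Proof.
move=> [Ke e0 ke].
have h0 : 0 < height e.
  rewrite lt_neqAle -{2}(repl rep) Ke andbT eq_sym; apply/eqP => h.
  by move/eqP: e0; apply; apply: (salient rep).
have eE : e = height e *: emb (dehom e).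
  by rewrite dehom_emb ?gt_eqF // scalerA mulfV ?scale1r ?gt_eqF.
split=> //; rewrite (closureX rep).
have fe i : f i e = height e * f i (emb (dehom e)) by rewrite -dotvZ -eE.
split.
- by move=> x /= ->; move=> i; rewrite -(pmulr_rge0 _ h0) -fe.
- by move=> a c t /= -> -> _; rewrite -scalerDl addrC subrK scale1r.
move=> a c t /= Ka Kc /andP[t0 t1] E.
have emE : emb (dehom e) = t *: emb a + (1 - t) *: emb c.
  rewrite -E /emb !scale_row_mx add_row_mx; congr row_mx.
  by apply/rowP => i; rewrite !mxE; ring.
have t1' : 0 < 1 - t by lra.
have k i : act F e i -> f i (emb a) = 0 /\ f i (emb c) = 0.
  move=> ei; have := fe i; rewrite (eqP ei) emE dotvD !dotvZ => /esym/eqP.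
  rewrite mulf_eq0 gt_eqF //= => /eqP s0.
  have h1 := mulr_ge0 (ltW t0) (Ka i); have h2 := mulr_ge0 (ltW t1') (Kc i).
  have /eqP : t * f i (emb a) = 0 by lra.
  rewrite mulf_eq0 (gt_eqF t0) /= => /eqP ->.
  have /eqP : (1 - t) * f i (emb c) = 0 by lra.
  by rewrite mulf_eq0 (gt_eqF t1') /= => /eqP ->.
have same x : (forall i, act F e i -> f i (emb x) = 0) -> x = dehom e.
  move=> /ke [s sE]; apply: emb_inj; rewrite sE {1}eE scalerA.
  have := repfl rep x; rewrite sE dotvZ (repl rep) => ->; exact: scale1r.
by split; apply: same => i /k [].
Qed.

Variables (G : set 'rV[R]_(n + 1)).
Hypothesis faceG : is_face (closure (coneX X)) G.

(** The segment from [c] through [z] extends beyond [z] inside [G]; a functional zero at [z] and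
    positive at [c] would turn negative there. *)
Lemma relint_act z c i : relint G z -> G c -> act F z i -> f i c = 0.
Proof.
move: faceG; rewrite (closure_coneX rep) => -[GK _ _] [Gz [e e0 H]] Gc zi.
apply/eqP; rewrite eq_le GK // andbT leNgt; apply/negP => pos.
pose t := e / (2 * (enorm (z - c) + 1)).
have d0 : 0 <= enorm (z - c) by exact: sqrtr_ge0.
have t0 : 0 < t by rewrite divr_gt0 //; lra.
have : G (z + t *: (z - c)).
  apply: H.
    exists 2%N, (fun i => if i == ord0 then 1 + t else - t),
      (fun i => if i == ord0 then z else c); split.
    - by move=> j; case: ifP.
    - by rewrite big_ord_recl big_ord1 /=; lra.
    - by rewrite big_ord_recl big_ord1 /= scalerDl scale1r scaleNr scalerBr addrA.
  rewrite addrC addKr enormZ gtr0_norm // /t mulrAC ltr_pdivrMr; last by lra.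
  by rewrite ltr_pM2l //; lra.
move=> /GK /(_ i); rewrite !dotvE (eqP zi) sub0r add0r mulrN oppr_ge0.
by rewrite leNgt mulr_gt0.
Qed.

(** For small [s], [z] is a proper convex combination of [q] and the cone vector
    [(1 - s)^-1 *: (z - s *: q)], so the face contains [q]. *)
Lemma relint_face z q : relint G z -> ccone F q ->
  (forall i, act F z i -> f i q = 0) -> G q.
Proof.
move: (faceG); rewrite (closure_coneX rep) => -[GK _ ext] Rz Kq kq.
have [Gz _] := Rz; have Kz := GK _ Gz.
have [] := @small_scale R N (fun i => if act F z i then 1 else f i z) (fun i => f i q).
  by move=> i; case: ifPn => // nz; rewrite (ccone_nact Kz).
move=> t /andP[t0 t1] Ht; pose s := t / 2.
have s0 : 0 < s by rewrite /s; lra.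
have s1 : s < 1 by rewrite /s; lra.
have Ka : ccone F ((1 - s)^-1 *: (z - s *: q)).
  move=> i; rewrite dotvZ; apply: mulr_ge0; first by rewrite invr_ge0; lra.
  have ss : 0 <= s <= t by apply/andP; rewrite /s; split; lra.
  have := Ht i s ss; rewrite !dotvE; case: ifPn => [zi _|_ H].
    by rewrite (eqP zi) kq // mulr0 subrr.
  by rewrite subr_ge0; apply: le_trans H; rewrite ler_wpM2l ?ler_norm ?ltW.
have := ext q ((1 - s)^-1 *: (z - s *: q)) s Kq Ka.
rewrite s0 s1 => /(_ isT) [] //.
rewrite scalerA mulfV ?scale1r; last by rewrite gt_eqF // subr_gt0.
by rewrite addrC subrK.
Qed.

Lemma relintE z : relint G z -> relint G = [set c | ccone F c /\ act F c =1 act F z].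
Proof.
move=> Rz; have [Gz _] := Rz.
have GK c : G c -> ccone F c by move: faceG; rewrite (closure_coneX rep) => -[+ _ _]; apply.
apply/seteqP; split=> c /=.
  move=> Rc; have [Gc _] := Rc; split; first exact: GK.
  by move=> i; apply/idP/idP => ci; apply/eqP; [exact: relint_act Rc Gz ci|exact: relint_act Rz Gc ci].
move=> [Kc cz]; split.
  by apply: (relint_face Rz) => // i; rewrite -cz => /eqP.
(* The sum of the [|F i 0 j|] is a Lipschitz constant of [f i], so functionals inactive at [c] stay
   nonnegative near [c]. *)
have [] := @small_scale R N (fun i => if act F c i then 1 else f i c)
    (fun i => \sum_j `|F i 0 j|).
  by move=> i; case: ifPn => // nz; rewrite (ccone_nact Kc).
move=> t /andP[t0 t1] Ht; exists t => // y Ay yt.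
have Ky i : act F z i -> f i y = 0.
  move: Ay => [k [cc [qq [Gq _ ->]]]] zi; rewrite dotv_sum big1 // => j _.
  by rewrite (relint_act Rz (Gq j) zi) mulr0.
apply: (relint_face Rz) => // i; have [zi|nz] := boolP (act F z i); first by rewrite Ky.
have := Ht i (enorm (y - c)); rewrite sqrtr_ge0 ltW // => /(_ isT).
rewrite cz (negbTE nz) => H.
have -> : f i y = f i c + f i (y - c) by rewrite dotvB; ring.
have : `|f i (y - c)| <= enorm (y - c) * `|\sum_j `|F i 0 j| |.
  have S0 : 0 <= \sum_j `|F i 0 j| by apply: sumr_ge0.
  rewrite (ger0_norm S0) mulr_sumr.
  apply: le_trans (ler_norm_sum _ _ _) _; apply: ler_sum => j _.
  by rewrite normrM mulrC ler_wpM2r // coord_enorm.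
move=> /le_trans /(_ H); rewrite ler_norml; lra.
Qed.

Hypothesis dimG : affdim G n.

(** Otherwise [z] is interior and [G] is the whole closed cone, which contains [n + 2] affinely
    independent points: [z] and its small shifts along the coordinate axes. *)
Lemma facet_act_neq0 z : relint G z -> exists i, act F z i.
Proof.
move=> Rz; have [Gz _] := Rz; apply: contrapT => /forallNP none.
have all c : ccone F c -> G c.
  by move=> Kc; apply: (relint_face Rz) => // i /none.
have Kz : ccone F z by move: faceG; rewrite (closure_coneX rep) => -[+ _ _]; apply.
have Cz : ocone F z by move=> i; apply: (ccone_nact Kz); apply/negP/none.
have [] := @small_scale R N (fun i => f i z) (fun i => \sum_j `|F i 0 j|) Cz.
move=> t /andP[t0 t1] Ht.
have [_ []] := dimG.
pose pt (i : 'I_n.+2) : 'rV[R]_(n + 1) :=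
  if unlift ord0 i is Some j then z + t *: delta_mx 0 (cast_ord (esym (addn1 n)) j) else z.
exists pt; split=> [i|].
  rewrite /pt; case: unliftP => [j _|_] //; apply: all => k; rewrite !dotvE.
  have := Ht k t; rewrite lexx ltW // => /(_ isT) H.
  have -> : f k (delta_mx 0 (cast_ord (esym (addn1 n)) j)) = F k 0 (cast_ord (esym (addn1 n)) j).
    rewrite /dotv (bigD1 (cast_ord (esym (addn1 n)) j)) //= mxE !eqxx mulr1 big1 ?addr0 // => i' ne.
    by rewrite mxE (negbTE ne) andbF mulr0.
  move: (cast_ord _ j) => j'.
  have h : `|F k 0 j'| <= `|\sum_j `|F k 0 j| |.
    have S0 : 0 <= \sum_j `|F k 0 j| by apply: sumr_ge0.
    by rewrite (ger0_norm S0) (bigD1 j') //= lerDl; apply: sumr_ge0.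
  have h2 := ler_wpM2l (ltW t0) h.
  have h3 := ler_norm (- F k 0 j'); rewrite normrN in h3.
  have h4 := ler_wpM2l (ltW t0) h3; lra.
apply: inj_row_free => v /rowP E; apply/rowP => i; rewrite mxE.
have := E (cast_ord (esym (addn1 n)) i); rewrite !mxE (bigD1 i) //= big1 => [|j ne].
  rewrite addr0 !mxE /pt liftK unlift_none !mxE !eqxx mulr1 addrC addKr => /eqP.
  by rewrite mulf_eq0 (gt_eqF t0) orbF => /eqP.
rewrite !mxE /pt liftK unlift_none !mxE eqxx /= (inj_eq (@cast_ord_inj _ _ _)).
by rewrite eq_sym (negbTE ne) mulr0 addr0 subrr mulr0.
Qed.

(** Active functionals annihilate the [n] independent differences of points of [G], and in dimension
    [n + 1] the annihilator of these is a line. *)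
Lemma facet_act_prop z i i0 : relint G z -> act F z i0 -> act F z i ->
  exists k, forall c, f i c = k * f i0 c.
Proof.
move=> Rz zi0 zi; have [[p [Gp free]] _] := dimG.
pose D := \matrix_(i < n) (p (lift ord0 i) - p ord0).
have kill k : act F z k -> (F k <= kermx D^T)%MS.
  move=> zk; apply/sub_kermxP/rowP => j; rewrite !mxE.
  transitivity (f k (p (lift ord0 j) - p ord0)).
    by apply: eq_bigr => i' _; rewrite !mxE.
  by rewrite dotvB !(relint_act Rz _ zk) ?subrr.
have rk : \rank (kermx D^T) = 1%N.
  by rewrite mxrank_ker mxrank_tr (eqP (free : row_free D)) addnC addnK.
have [_ _ _ [x /(repP rep) Cx]] := rep.
have nz : \rank (F i0) = 1%N.
  apply/eqP; rewrite rank_rV eqb1; apply/eqP => E; have := Cx i0.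
  by rewrite E /dotv big1 ?ltxx // => j _; rewrite mxE mul0r.
have : (F i <= F i0)%MS.
  apply: submx_trans (kill _ zi) _.
  by rewrite -(mxrank_leqif_sup (kill _ zi0)) nz rk.
case/sub_rVP => k ->; exists k => c.
by rewrite /dotv mulr_sumr; apply: eq_bigr => j _; rewrite mxE mulrA.
Qed.

End Faces.

(** * Simplices as sections of cones with [n + 1] generators *)

Section Simplex.
Variables (R : realType) (n N : nat) (X : set 'rV[R]_n).
Variables (F : 'I_N -> 'rV[R]_(n + 1)) (l : 'I_N).
Local Notation f i c := (dotv (F i) c).
Hypothesis rep : cone_rep X F l.

(** The cone has an interior point, so every vector is a multiple of a difference of two cone
    vectors. *)
Lemma generators_row_full k (q : 'I_k -> 'rV[R]_(n + 1)) :
  (forall c, ccone F c -> exists a : 'I_k -> R, c = \sum_i a i *: q i) ->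
  row_full (\matrix_i q i).
Proof.
move=> gen; rewrite -sub1mx; apply/row_subP => j.
have sub c : ccone F c -> (c <= \matrix_i q i)%MS.
  move=> /gen [a ->]; apply: summx_sub => i _; apply: scalemx_sub.
  by rewrite -(rowK q i) row_sub.
have [_ _ _ [x /(repP rep) Cx]] := rep.
move: (row j 1%:M) => c.
have [t /andP[t0 _] Ht] := small_scale (fun i => f i c) Cx.
have Kt : ccone F (emb x + t *: c).
  move=> i; rewrite !dotvE; have := Ht i t; rewrite lexx ltW // => /(_ isT) h1.
  have := ler_norm (- f i c); rewrite normrN => h2.
  have := ler_wpM2l (ltW t0) h2; lra.
have -> : c = t^-1 *: ((emb x + t *: c) - emb x).
  by rewrite addrC addKr scalerA mulVf ?scale1r // gt_eqF.
apply: scalemx_sub; apply: addmx_sub; first exact: sub.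
by rewrite eqmx_opp; apply: sub; apply: ocone_ccone.
Qed.

Lemma emb_comb k (c : 'I_k -> R) (p : 'I_k -> 'rV[R]_n) :
  \sum_i c i = 1 -> emb (\sum_i c i *: p i) = \sum_i c i *: emb (p i).
Proof.
move=> c1; apply/rowP => j; rewrite summxE.
case: (splitP j) => i ij.
  have -> : j = lshift 1 i by exact: val_inj.
  rewrite /emb row_mxEl summxE; apply: eq_bigr => h _.
  by rewrite [in RHS]mxE row_mxEl mxE.
have -> : j = rshift n i by exact: val_inj.
rewrite /emb row_mxEr mxE -[LHS]c1; apply: eq_bigr => h _.
by rewrite mxE row_mxEr mxE mulr1.
Qed.

Lemma interior_closureX : interior (closure X) = X.
Proof.
have [_ _ _ [b /(repP rep) Cb]] := rep.
rewrite (closureX rep); apply/seteqP; split=> x /=.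
  move=> /(segment_nbhs (x - b)) [e e0 H]; apply/(repP rep) => i.
  have := H (e / 2); rewrite gtr0_norm ?divr_gt0 // => /(_ _ i).
  rewrite emb_line !dotvE => H1; have {}H1 := H1 _.
  have h2 : e / 2 < e by lra.
  have := H1 h2; have e2 : 0 < e / 2 by lra.
  have := mulr_gt0 e2 (Cb i) => h3 h4.
  have h5 : 0 < (1 + e / 2) * f i (emb x) by lra.
  by rewrite -(pmulr_rgt0 _ (_ : 0 < 1 + e / 2)) //; lra.
move=> /(repP rep) Cx.
have : \forall y \near x, forall i, 0 < f i (emb y).
  apply: (@filter_forall _ _ (fun i y => 0 < f i (emb y)) (nbhs x) (nbhs_filter x)) => i.
  have /(_ [set z | 0 < z]) := @dotv_emb_continuous _ _ (F i) x.
  by apply; exact: lt_nbhsr (Cx i).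
by apply: filterS => y H i; apply: ltW.
Qed.

(** The [n + 1] generators span, hence are independent, which gives affine independence of [p]; at
    height 1 the coefficients sum to 1. *)
Lemma open_simplex_of_generators (p : 'I_n.+1 -> 'rV[R]_n) :
  (forall i, ccone F (emb (p i))) ->
  (forall c, ccone F c -> exists a : 'I_n.+1 -> R,
     (forall i, 0 <= a i) /\ c = \sum_i a i *: emb (p i)) ->
  open_simplex X.
Proof.
move=> Kp gen; exists p.
  pose E := \matrix_i emb (p i).
  have fE : row_free E.
    have : row_full E by apply: generators_row_full => c /gen [a [_ ->]]; exists a.
    by rewrite /row_free /row_full => /eqP ->; rewrite addn1.
  apply: inj_row_free => u uD.
  (* Turns a relation among the differences [p i - p ord0] into a linear relation among the
     [emb (p i)]. *)
  pose w : 'rV[R]_n.+1 := \row_i (if unlift ord0 i is Some j then u 0 j else - \sum_j u 0 j).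
  have wE : w *m E = 0.
    rewrite mulmx_sum_row big_ord_recl /w mxE unlift_none rowK.
    under [X in _ + X]eq_bigr do rewrite mxE liftK rowK.
    rewrite scaleNr scaler_suml addrC -sumrB.
    under eq_bigr do rewrite -scalerBr embB.
    transitivity (row_mx (u *m \matrix_(i < n) (p (lift ord0 i) - p ord0)) (0 : 'rV[R]_1)).
      rewrite mulmx_sum_row; under [in RHS]eq_bigr do rewrite rowK.
      apply/rowP => j; rewrite summxE; case: (splitP j) => i ij.
        have -> : j = lshift 1 i by exact: val_inj.
        by rewrite row_mxEl summxE; apply: eq_bigr => h _; rewrite mxE row_mxEl [in RHS]mxE.
      have -> : j = rshift n i by exact: val_inj.
      by rewrite row_mxEr mxE big1 // => h _; rewrite mxE row_mxEr mxE mulr0.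
    by rewrite uD row_mx0.
  have w0 : w = 0 by apply: (row_free_inj fE); rewrite wE mul0mx.
  apply/rowP => j; have /rowP/(_ (lift ord0 j)) := w0.
  by rewrite !mxE liftK.
rewrite -[LHS]interior_closureX; congr interior; rewrite (closureX rep).
apply/seteqP; split=> y /=.
  move=> /gen [a [a0 E]].
  have a1 : \sum_i a i = 1.
    rewrite -(repfl rep y) E dotv_sum; apply: eq_bigr => i _.
    by rewrite (repfl rep) mulr1.
  by exists a; split=> //; apply: emb_inj; rewrite emb_comb.
move=> [a [a0 a1 ->]] i; rewrite emb_comb // dotv_sum sumr_ge0 // => j _.
by rewrite mulr_ge0 ?Kp.
Qed.

End Simplex.

(** Separates the parts of different vertices: at [x1 + e *: b] with [e] small, [qf x1 p1] is at
    most [e * B], while [qf x2 p2] stays above a positive constant if some functional active at [x2]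
    is positive at [x1]. *)
Lemma qf_distinct (R : realType) (m N : nat) (F : 'I_N -> 'rV[R]_m) b x1 x2 p1 p2 k i1 :
  (forall c, (forall i, dotv (F i) c = 0) -> c = 0) ->
  ocone F b -> extray F x1 -> extray F x2 -> act F x1 i1 ->
  (forall i, act F x1 i -> 0 < dotv (F i) p1) ->
  (forall i, act F x2 i -> 0 < dotv (F i) p2) -> 0 < k ->
  (forall w, ocone F w -> qf F x1 p1 w = k * qf F x2 p2 w) -> exists t, x1 = t *: x2.
Proof.
move=> pointed Cb [K1 n1 _] [K2 n2 k2] a1 T1 T2 k0 E; apply: k2 => i ai.
apply/eqP; rewrite eq_le K1 andbT leNgt; apply/negP => pos.
have [j xj] := ccone_neq0 pointed K2 n2.
pose B := rmax F (act F x1) b p1.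
pose c := dotv (F i) x1 / dotv (F i) p2 * (dotv (F j) x2 / (dotv (F j) x1 + dotv (F j) b)).
have d0 : 0 < dotv (F j) x1 + dotv (F j) b by have := K1 j; have := Cb j; lra.
have c0 : 0 < c by rewrite mulr_gt0 // divr_gt0 // T2.
have [e /andP[e0 e1] He] := exists_small (rmax_ge0 F (act F x1) b p1 : 0 <= B) (mulr_gt0 k0 c0).
have Cw : ocone F (x1 + e *: b).
  by move=> h; rewrite !dotvE; have := K1 h; have := mulr_gt0 e0 (Cb h); lra.
have up : qf F x1 p1 (x1 + e *: b) <= e * B.
  rewrite -[leRHS]mulr1; apply: ler_pM; rewrite ?rmax_ge0 //.
    apply: rmax_lub => [|h ah]; first by rewrite mulr_ge0 ?rmax_ge0 // ltW.
    split; first exact: T1.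
    rewrite !dotvE (eqP ah) add0r -mulrA ler_pM2l //.
    exact: (rmax_ub b ah (T1 h ah)).
  apply: rmax_lub => // h _; split=> //.
  by rewrite mul1r !dotvE lerDl mulr_ge0 // ltW.
have low : c <= qf F x2 p2 (x1 + e *: b).
  apply: ler_pM.
  - by rewrite divr_ge0 // ltW // T2.
  - by rewrite divr_ge0 // ltW.
  - rewrite ler_pdivrMr ?T2 //.
    apply: le_trans (rmax_ub (x1 + e *: b) ai (T2 i ai)).
    by rewrite !dotvE lerDl mulr_ge0 // ltW.
  - rewrite ler_pdivrMr //.
    apply: le_trans (rmax_ub x2 (isT : xpredT j) (Cw j)) _.
    apply: ler_wpM2l; first exact: rmax_ge0.
    rewrite !dotvE lerD2l -[leRHS]mul1r ler_wpM2r //; exact: ltW.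
have := E _ Cw; have := ler_wpM2l (ltW k0) low; lra.
Qed.

Lemma extrayZ (R : realType) (m N : nat) (F : 'I_N -> 'rV[R]_m) e t :
  0 < t -> extray F e -> extray F (t *: e).
Proof.
move=> t0 [Ke e0 ke]; split.
- by move=> i; rewrite dotvZ mulr_ge0 // ltW.
- by rewrite scaler_eq0 negb_or e0 gt_eqF.
- move=> c kc; have [|s ->] := ke c.
    by move=> i ei; apply: kc; rewrite /act dotvZ (eqP ei) mulr0.
  by exists (s / t); rewrite scalerA divfK // gt_eqF.
Qed.

Lemma actZ (R : realType) (m N : nat) (F : 'I_N -> 'rV[R]_m) e t :
  0 < t -> act F (t *: e) =1 act F e.
Proof. by move=> t0 i; rewrite /act dotvZ mulf_eq0 gt_eqF. Qed.

(** * Transport of Busemann functions by the isometry *)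

Section Isometry.
Variables (R : realType) (n NX NY : nat) (X Y : set 'rV[R]_n).
Variables (FX : 'I_NX -> 'rV[R]_(n + 1)) (lX : 'I_NX).
Variables (FY : 'I_NY -> 'rV[R]_(n + 1)) (lY : 'I_NY).
Variables (g : 'rV[R]_n -> 'rV[R]_n) (bX bY : 'rV[R]_n).
Hypotheses (repX : cone_rep X FX lX) (repY : cone_rep Y FY lY).
Hypotheses (isog : isometry_onto X Y g) (XbX : X bX) (YbY : Y bY).
Implicit Types (x y z p e u c : 'rV[R]_(n + 1)) (v w : 'rV[R]_n).

Lemma isometry_inj w w' : X w -> X w' -> g w = g w' -> w = w'.
Proof.
have [_ _ iso] := isog; move=> Xw Xw' E; apply: contrapT => /eqP ne.
have := iso _ _ Xw Xw'; rewrite E {1}/hdist eqxx (hdistE repX) // => /esym /eqP.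
have r1 := rmax_gt1 repX Xw Xw' ne.
have r2 : 1 < rmax FX predT (emb w) (emb w') by rewrite (rmax_gt1 repX) // eq_sym.
by rewrite gt_eqF // ln_gt0 // -[1]mulr1 ltr_pM.
Qed.

Lemma ginvP w : X w -> ginv X g (g w) = w.
Proof.
move=> Xw; have [Xw' E] : X (ginv X g (g w)) /\ g (ginv X g (g w)) = g w.
  exact: (@xgetPex _ 0 [set x | X x /\ g x = g w]) (ex_intro _ w (conj Xw erefl)).
exact: isometry_inj.
Qed.

(** After exponentiation the additive constants of the Busemann functions become the factor [k],
    read off at [bY] and its preimage. *)
Lemma hat_qf x z p i0 y z' p' j0 :
  ccone FX x -> x != 0 -> act FX x i0 -> ccone FX z -> act FX z =1 act FX x ->
  tau (coneX X) z p ->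
  ccone FY y -> y != 0 -> act FY y j0 -> ccone FY z' -> act FY z' =1 act FY y ->
  tau (coneX Y) z' p' ->
  hatg X Y g bY (busf X bX x (tau (coneX X) z) p) = busf Y bY y (tau (coneX Y) z') p' ->
  exists2 k, 0 < k & forall w, X w -> qf FX x p (emb w) = k * qf FY y p' (emb (g w)).
Proof.
move=> Kx x0 xi Kz zx pz Ky y0 yj Kz' zy pz'; rewrite (busfE repX XbX Kx x0 xi Kz zx pz).
rewrite (busfE repY YbY Ky y0 yj Kz' zy pz') => E.
have [gY onto _] := isog; have [b0 Xb0 gb0] := onto _ YbY.
have pos w : X w -> 0 < qf FX x p (emb w).
  move=> /(repP repX) Cw; apply: (qf_gt0 (rep_pointed repX) Kx x0 xi) => // i.
  by rewrite -zx; move: pz; rewrite (tauE repX Kz); apply.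
have pos' w : Y w -> 0 < qf FY y p' (emb w).
  move=> /(repP repY) Cw; apply: (qf_gt0 (rep_pointed repY) Ky y0 yj) => // i.
  by rewrite -zy; move: pz'; rewrite (tauE repY Kz'); apply.
exists (qf FX x p (emb b0) / qf FY y p' (emb bY)); first by rewrite divr_gt0 ?pos ?pos'.
move=> w Xw; have := congr1 (fun h => h (g w)) E.
have Ygw := gY _ Xw; have gib : ginv X g bY = b0 by rewrite -gb0 ginvP.
rewrite /hatg /restr /= gib ginvP // !asboolT // => H.
have q1 := pos _ Xw; have q2 := pos _ Xb0; have q3 := pos' _ Ygw; have q4 := pos' _ YbY.
have q5 := divr_gt0 q2 q4; have q6 := mulr_gt0 q5 q3.
move: (qf FX x p (emb b0)) (qf FX x p (emb w)) (qf FX x p (emb bX)) (qf FY y p' (emb (g w)))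
  (qf FY y p' (emb bY)) q1 q2 q3 q4 q5 q6 H => a1 a2 a3 a4 a5 q1 q2 q3 q4 q5 q6 H.
apply: ln_inj; rewrite ?posrE //.
rewrite lnM ?posrE // ln_div ?posrE //; lra.
Qed.

(* The segment from [w] towards the vertex [v] is the unique curve of steepest descent of a
   function in the part of [v]; its image must be the only such curve in [Y], which forces
   the line from [y] through [g w] to leave [Y] at a vertex. *)
Lemma apex_of_qf v i0 y p' j0 k w :
  extray FX (emb v) -> act FX (emb v) i0 ->
  ccone FY y -> y != 0 -> act FY y j0 ->
  (forall i, act FY y i -> exists k, forall c, dotv (FY i) c = k * dotv (FY j0) c) ->
  (forall i, act FY y i -> 0 < dotv (FY i) p') ->
  X w -> 0 < k ->
  (forall w1, X w1 -> qf FX (emb v) (emb w) (emb w1) = k * qf FY y p' (emb (g w1))) ->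
  extray FY (emb (g w) - (rmax FY predT y (emb (g w)))^-1 *: y).
Proof.
move=> Ev vi Ky y0 yj prop py Xw k0 Q.
have [gY onto iso] := isog.
set u := emb (g w); have Cu : ocone FY u by apply/(repP repY)/gY.
(* It remains to show that a perturbation direction [e] is zero. The points [u + y + t *: e], scaled
   to height 1, are images of points on the unique descent curve of [v], all at one distance from
   [w]. *)
apply: (extray_proj (rep_pointed repY) Ky y0 yj Cu prop) => e eI eJ.
have [h h0 H] := qf_perturb (rep_pointed repY) p' Ky y0 yj Cu eI eJ.
set A := rmax FY predT y u in H.
have key t : 0 <= t <= h -> exists w1, [/\ X w1,
    emb (g w1) = (height (u + y + t *: e))^-1 *: (u + y + t *: e),
    rmax FX predT (emb w) (emb w1) * rmax FX predT (emb w1) (emb w) = 1 + A &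
    (1 + A) * qf FX (emb v) (emb w) (emb w1) = qf FX (emb v) (emb w) (emb w)].
  move=> /H [Cu' r1 r2 q]; move: (u + y + t *: e) Cu' r1 r2 q => u' Cu' r1 r2 q.
  have [Yu' E] := dehom_ocone repY Cu'; have [w1 Xw1 gw1] := onto _ Yu'.
  have h'0 : 0 < height u' by rewrite -(repl repY).
  have hi : 0 < (height u')^-1 by rewrite invr_gt0.
  have A1 : 0 < 1 + A by rewrite -r2; apply: (rmax_gt0 (i := j0)).
  exists w1; split=> //; first by rewrite gw1 E.
    have := iso _ _ Xw Xw1; rewrite (hdistE repX) // (hdistE repY) //; try exact: gY.
    rewrite gw1 E -/u (rmaxZr _ _ _ _ hi) (rmaxZl _ _ _ _ (ltW hi)) r1 r2 invrK => D.
    have C1 := proj1 (repP repX w) Xw; have C2 := proj1 (repP repX w1) Xw1.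
    have D' : ln (1 + A) = ln (rmax FX predT (emb w) (emb w1) * rmax FX predT (emb w1) (emb w)).
      by rewrite -D; congr ln; field; rewrite gt_eqF.
    by symmetry; apply: ln_inj D'; rewrite posrE // mulr_gt0 // (rmax_gt0 (i := lX)).
  rewrite !Q // gw1 E qfZ ?invr_gt0 // -/u -q; ring.
have hh : 0 <= h <= h by rewrite ltW /=.
have h00 : (0 : R) <= 0 <= h by rewrite lexx /= ltW.
have [w0 [Xw0 g0 D0 Q0]] := key 0 h00; have [w1 [Xw1 g1 D1 Q1]] := key h hh.
have Ew : emb w0 = emb w1.
  apply: (@steepest_unique _ _ _ FX (rep_pointed repX) (emb v) (emb w) _ _ i0 lX) => //;
    try by apply/(repP repX).
  - by rewrite (repfl repX) ltr01.
  - by rewrite !(repfl repX).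
  - by rewrite !(repfl repX).
  - by rewrite D0 D1.
  - by rewrite D0.
  - by rewrite D1.
have [C0 _ _ _] := H 0 h00; have [C1 _ _ _] := H h hh.
have fj t : dotv (FY j0) (u + y + t *: e) = dotv (FY j0) u.
  by rewrite !dotvE (eI _ yj) (eqP yj) mulr0 !addr0.
have EE : (height (u + y + 0 *: e))^-1 *: (u + y + 0 *: e) =
    (height (u + y + h *: e))^-1 *: (u + y + h *: e).
  by rewrite -g0 -g1 (emb_inj Ew).
(* The functional of index [j0] takes the same value at both vectors, so proportionality forces
   equal heights, and then [h *: e = 0]. *)
have hE : height (u + y + 0 *: e) = height (u + y + h *: e).
  have := congr1 (dotv (FY j0)) EE; rewrite !dotvZ !fj.
  by move=> /(mulIf (lt0r_neq0 (Cu j0))) /invr_inj.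
move: EE; rewrite hE => /(scalerI _).
have hn : (height (u + y + h *: e))^-1 != 0.
  by rewrite invr_eq0 -(repl repY) gt_eqF.
move=> /(_ hn); rewrite scale0r addr0 => /eqP; rewrite -subr_eq0 opprD addrA subrr sub0r.
by rewrite oppr_eq0 scaler_eq0 gt_eqF //= => /eqP.
Qed.

End Isometry.

(** A family that does not exhaust [P] extends by one more element, which cannot continue past
    [B]. *)
Lemma bounded_enum (T : Type) (P : T -> Prop) B :
  (forall k (p : 'I_k -> T), injective p -> (forall i, P (p i)) -> (k <= B)%N) ->
  exists k (p : 'I_k -> T),
    [/\ injective p, forall i, P (p i) & forall x, P x -> exists i, x = p i].
Proof.
move=> bd; apply: contrapT => none.
suff all k : exists p : 'I_k -> T, injective p /\ forall i, P (p i).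
  by have [p [inj Pp]] := all B.+1; have := bd _ p inj Pp; rewrite ltnn.
elim: k => [|k [p [inj Pp]]].
  by have f : 'I_0 -> T by [move=> [] | ]; exists f; split=> -[].
have [x Px nx] : exists2 x, P x & forall i, x <> p i.
  apply: contrapT => /forall2NP H; apply: none; exists k, p; split=> // x Px.
  have [//|nx] := H x; apply: contrapT => /forallNP ni.
  by apply: nx => i /(ni i).
exists (fun i => if unlift ord0 i is Some j then p j else x); split=> [i j|i]; last first.
  by case: unliftP.
case: (unliftP ord0 i) => [i'|] ->; case: (unliftP ord0 j) => [j'|] -> //.
- by move/inj->.
- by move/esym/nx.
- by move/nx.
Qed.

(** Without an active functional every vector would be a multiple of [e], including a nonzero one of
    height 0. *)
Lemma extray_act (R : realType) (n N : nat) (X : set 'rV[R]_n)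
  (F : 'I_N -> 'rV[R]_(n + 1)) (l : 'I_N) e :
  (0 < n)%N -> cone_rep X F l -> extray F e -> exists i, act F e i.
Proof.
move=> n0 rep Ee; have [h0 _ _] := extray_vertex rep Ee; have [_ _ ke] := Ee.
apply: contrapT => /forallNP none.
pose c : 'rV[R]_(n + 1) := row_mx (const_mx 1) 0.
have [t cE] : exists t, c = t *: e by apply: ke => i /none.
have hc : height c = 0 by rewrite /height row_mxEr mxE.
move: hc; rewrite cE -(repl rep) dotvZ (repl rep) => /eqP.
rewrite mulf_eq0 (gt_eqF h0) orbF => /eqP t0.
have := congr1 (fun m : 'rV[R]_(n + 1) => m 0 (lshift 1 (Ordinal n0))) cE.
rewrite t0 scale0r row_mxEl !mxE => /eqP; by rewrite oner_eq0.
Qed.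

(** * Apexes in [Y] attached to the vertices of [X] *)

Section Apex.
Variables (R : realType) (n NX NY : nat) (X Y : set 'rV[R]_n).
Variables (FX : 'I_NX -> 'rV[R]_(n + 1)) (lX : 'I_NX).
Variables (FY : 'I_NY -> 'rV[R]_(n + 1)) (lY : 'I_NY).
Variables (g : 'rV[R]_n -> 'rV[R]_n) (bX bY : 'rV[R]_n).
Hypotheses (repX : cone_rep X FX lX) (repY : cone_rep Y FY lY).
Hypotheses (isog : isometry_onto X Y g) (XbX : X bX) (YbY : Y bY) (n0 : (0 < n)%N).
Hypothesis vertex_to_facet : forall P,
  vertex_part X bX P -> facet_part Y bY (hatg X Y g bY @` P).
Implicit Types (x y z p e u c : 'rV[R]_(n + 1)) (v w : 'rV[R]_n) (I : pred 'I_NY).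

Definition vertex v := is_face (closure X) [set v].

(** [I] is the active set of the base facet, [i0] one functional defining that facet, and [e] spans
    the apex ray. *)
Definition pyramid i0 e I := [/\ I i0, extray FY e, 0 < dotv (FY i0) e,
  forall u, ocone FY u -> exists t y,
    [/\ 0 < t, ccone FY y, act FY y =1 I & u = t *: e + y] &
  forall e', extray FY e' -> 0 < dotv (FY i0) e' -> exists2 t, 0 < t & e' = t *: e].

(** The second clause keeps the converse direction of the equality of parts: each function of the
    facet part comes from the part of [v]. It serves to recover [v] from the facet. *)
Lemma vertex_pyramid v : vertex v -> exists i0 e I, pyramid i0 e I /\
  forall y p', ccone FY y -> act FY y =1 I -> (forall i, I i -> 0 < dotv (FY i) p') ->
  exists s p k, [/\ 0 < s, (forall i, act FX (emb v) i -> 0 < dotv (FX i) p), 0 < k &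
    forall w, X w -> qf FX (s *: emb v) p (emb w) = k * qf FY y p' (emb (g w))].
Proof.
move=> Vv; have Ev := vertex_extray repX Vv; have [Kv v0 _] := Ev.
have [i1 vi] := extray_act n0 repX Ev.
have ov : oray v (emb v) by exists 1; rewrite ?ltr01 ?scale1r.
have [gY onto _] := isog.
have [|G [fG dG [z' Rz' EG]]] := vertex_to_facet (P := partP X bX (oray v) (tau (coneX X) (emb v))).
  by exists v; split=> //; exists (emb v).
have [j0 zj] := facet_act_neq0 repY fG dG Rz'.
have RE := relintE repY fG Rz'.
have [Kz' _] : ccone FY z' /\ act FY z' =1 act FY z' by have := Rz'; rewrite {1}RE.
have z0 : z' != 0.
  apply/eqP => E; have G0 c : G c -> c = 0.
    move=> Gc; apply: (rep_pointed repY) => i; apply: (relint_act repY fG Rz' Gc).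
    by rewrite E /act dotv0.
  have [[p [Gp +]] _] := dG.
  rewrite /aff_indep; have -> : \matrix_(i < n) (p (lift ord0 i) - p ord0) = 0.
    by apply/row_matrixP => i; rewrite rowK row0 !(G0 _ (Gp _)) subrr.
  by rewrite /row_free mxrank0 eq_sym gtn_eqF.
have ny y : act FY y =1 act FY z' -> y != 0.
  move=> yz; apply: contraNN z0 => /eqP E; apply/eqP; apply: (rep_pointed repY) => i.
  by apply/eqP; have := yz i; rewrite E {1}/act dotv0 eqxx /act => <-.
(* Taking [p = emb w] with [g w] on the ray of [u] makes the descent curve start at [w], so
   [apex_of_qf] splits [u] into an extreme ray and a point of the facet. *)
have step u : ocone FY u -> exists e y, [/\ extray FY e, 0 < dotv (FY j0) e, ccone FY y,
    act FY y =1 act FY z' & u = e + y].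
  move=> Cu; have [Yu uE] := dehom_ocone repY Cu.
  have hu : 0 < height u by rewrite -(repl repY).
  have [w Xw gw] := onto _ Yu; have Cw := proj1 (repP repX w) Xw.
  have tw : tau (coneX X) (emb v) (emb w) by rewrite (tauE repX Kv) /=.
  have : (hatg X Y g bY @` partP X bX (oray v) (tau (coneX X) (emb v)))
      (hatg X Y g bY (busf X bX (emb v) (tau (coneX X) (emb v)) (emb w))).
    by exists (busf X bX (emb v) (tau (coneX X) (emb v)) (emb w)) => //; exists (emb v), (emb w).
  rewrite EG => -[y [p' [Ry tp' E]]].
  have [Ky yz] : ccone FY y /\ act FY y =1 act FY z' by have := Ry; rewrite {1}RE.
  have yj : act FY y j0 by rewrite yz.
  have [k k0 Q] := hat_qf repX repY isog XbX YbY Kv v0 vi Kv (frefl _) tw Ky (ny _ yz) yj Kz'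
    (fsym yz) tp' E.
  have Ee : extray FY (emb (g w) - (rmax FY predT y (emb (g w)))^-1 *: y).
    apply: (apex_of_qf repX repY isog Ev vi Ky (ny _ yz) yj _ _ Xw k0 Q) => i.
      by rewrite yz => zi; apply: (facet_act_prop repY fG dG Rz' zj zi).
    by rewrite yz; move: tp'; rewrite (tauE repY Kz'); apply.
  have Cgw := proj1 (repP repY (g w)) (gY _ Xw).
  have [i yi] := ccone_neq0 (rep_pointed repY) Ky (ny _ yz).
  set A := rmax FY predT y (emb (g w)) in Ee *.
  have A0 : 0 < A by rewrite (rmax_gt0 (i := i)).
  have hA : 0 < height u * A^-1 by rewrite mulr_gt0 ?invr_gt0.
  exists (height u *: (emb (g w) - A^-1 *: y)), ((height u * A^-1) *: y); split.
  - exact: extrayZ.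
  - by rewrite dotvZ dotvB dotvZ (eqP yj) mulr0 subr0 mulr_gt0.
  - by move=> h; rewrite dotvZ mulr_ge0 // ltW.
  - by move=> h; rewrite actZ.
  - by rewrite scalerBr scalerA subrK gw uE scalerA mulfV ?scale1r // gt_eqF.
have Cb := proj1 (repP repY bY) YbY.
have [e [_ [Ee ej _ _ _]]] := step _ Cb.
have step' u : ocone FY u -> exists e y, [/\ extray FY e, 0 < dotv (FY j0) e, ccone FY y,
    dotv (FY j0) y = 0 & u = e + y].
  move=> /step [e' [y [? ? ? yz ?]]]; exists e', y; split=> //.
  by apply/eqP; have := yz j0; rewrite zj.
have uniq e' : extray FY e' -> 0 < dotv (FY j0) e' -> exists2 t, 0 < t & e' = t *: e.
  move=> Ee' ej'; have [t tE] := apex_unique Cb step' Ee Ee' ej ej'.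
  by exists t => //; move: ej'; rewrite tE dotvZ pmulr_lgt0.
exists j0, e, (act FY z'); split.
  split=> // u /step [e' [y [Ee' ej' Ky yz ->]]].
  by have [t t0 ->] := uniq _ Ee' ej'; exists t, y.
move=> y p' Ky yz tp'.
have tp : tau (coneX Y) z' p' by rewrite (tauE repY Kz').
have : partP Y bY (relint G) (tau (coneX Y) z') (busf Y bY y (tau (coneX Y) z') p').
  by exists y, p'; split=> //; rewrite RE.
rewrite -EG => -[xi [x [p [[s s0 xE] tx ->]]] E].
have Kx : ccone FX x by move=> i; rewrite xE dotvZ mulr_ge0 // ltW.
have x0 : x != 0 by rewrite xE scaler_eq0 negb_or v0 gt_eqF.
have xv : act FX x =1 act FX (emb v) by move=> i; rewrite xE actZ.
have xi1 : act FX x i1 by rewrite xv.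
have yj : act FY y j0 by rewrite yz.
have [k k0 Q] := hat_qf repX repY isog XbX YbY Kx x0 xi1 Kv (fsym xv) tx Ky (ny _ yz) yj Kz'
    (fsym yz) tp E.
exists s, p, k; split=> //; last by rewrite -xE.
by move=> i; move: tx; rewrite (tauE repX Kv); apply.
Qed.

(** If [e v'] were off the facet of [v], it would be a multiple of [e v]. Two pyramids with the same
    apex have the same base, so [v] and [v'] would share a facet part, against [qf_distinct]. *)
Lemma vertex_frame : exists (j : 'rV[R]_n -> 'I_NY) (e : 'rV[R]_n -> 'rV[R]_(n + 1)),
  (forall v, vertex v -> extray FY (e v) /\ 0 < dotv (FY (j v)) (e v)) /\
  (forall v v', vertex v -> vertex v' -> v != v' -> dotv (FY (j v)) (e v') = 0).
Proof.
have /choice [d Hd] : forall v, exists d : 'I_NY * 'rV[R]_(n + 1) * pred 'I_NY, vertex v ->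
    pyramid d.1.1 d.1.2 d.2 /\
    forall y p', ccone FY y -> act FY y =1 d.2 -> (forall i, d.2 i -> 0 < dotv (FY i) p') ->
    exists s p k, [/\ 0 < s, (forall i, act FX (emb v) i -> 0 < dotv (FX i) p), 0 < k &
      forall w, X w -> qf FX (s *: emb v) p (emb w) = k * qf FY y p' (emb (g w))].
  move=> v; have [Vv|nV] := pselect (vertex v); last by exists (lY, 0, xpredT).
  by have [i0 [e [I HI]]] := vertex_pyramid Vv; exists (i0, e, I).
exists (fun v => (d v).1.1), (fun v => (d v).1.2); split.
  by move=> v /Hd [[]].
move=> v v' Vv Vv' ne.
have [[I1 E1 e1 C1 U1] L1] := Hd v Vv; have [[I2 E2 e2 C2 _] L2] := Hd v' Vv'.
move: (d v).1.1 (d v).1.2 (d v).2 (d v').1.1 (d v').1.2 (d v').2 I1 E1 e1 C1 U1 L1 I2 E2 e2 C2 L2.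
move=> i1 f1 A1 i2 f2 A2 I1 E1 e1 C1 U1 L1 I2 E2 e2 C2 L2.
have [K2 _ _] := E2.
apply/eqP; rewrite eq_le K2 andbT leNgt; apply/negP => pos.
have [t t0 tE] := U1 _ E2 pos.
have Cb := proj1 (repP repY bY) YbY.
have [t1 [y1 [t10 Ky1 y1A u1]]] := C1 _ Cb; have [t2 [y2 [t20 Ky2 y2A u2]]] := C2 _ Cb.
have yE : y2 = y1 + (t1 - t2 * t) *: f1.
  by rewrite scalerBl -scalerA -tE addrA (addrC y1) -u1 u2 addrC addKr.
have f1pos i : act FY y1 i -> 0 < dotv (FY i) f1.
  move=> /eqP yi; have := Cb i; rewrite u1 dotvD dotvZ yi addr0.
  by rewrite pmulr_rgt0.
have y1i : act FY y1 i1 by rewrite y1A.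
(* The base points [y1] and [y2] differ by a multiple of the apex [f1]: a negative one moves [y2]
   out of the cone, a positive one into its interior, off every facet. *)
have [s0|s0|s0] := ltgtP (t1 - t2 * t) 0.
- have := Ky2 i1; rewrite yE dotvD dotvZ (eqP y1i) add0r.
  by rewrite leNgt nmulr_rlt0 ?f1pos.
- have : act FY y2 i2 by rewrite y2A.
  rewrite /act yE dotvD dotvZ; have [/f1pos p|/(ccone_nact Ky1) p] := boolP (act FY y1 i2).
    by rewrite gt_eqF // ltr_wpDl ?mulr_gt0.
  have [K1 _ _] := E1.
  by rewrite gt_eqF // ltr_wpDr // mulr_ge0 // ltW.
have yy : y2 = y1 by rewrite yE s0 scale0r addr0.
have [s1 [p1 [k1 [s10 T1 k10 Q1]]]] := L1 y1 (emb bY) Ky1 y1A (fun i _ => Cb i).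
have y12 : act FY y1 =1 A2 by move=> i; rewrite -y2A yy.
have [s2 [p2 [k2 [s20 T2 k20 Q2]]]] := L2 y1 (emb bY) Ky1 y12 (fun i _ => Cb i).
have Ev := vertex_extray repX Vv; have Ev' := vertex_extray repX Vv'.
have [a va] := extray_act n0 repX Ev.
have [||||||//||t' tE'] := @qf_distinct _ _ _ FX (emb bX) (s1 *: emb v) (s2 *: emb v') p1 p2 (k1 / k2) a
  (rep_pointed repX).
- exact/(repP repX).
- exact: extrayZ.
- exact: extrayZ.
- by rewrite actZ.
- by move=> i; rewrite actZ //; apply: T1.
- by move=> i; rewrite actZ //; apply: T2.
- by rewrite divr_gt0.
- move=> c Cc; have [Xc cE] := dehom_ocone repX Cc.
  have hc : 0 < (height c)^-1 by rewrite invr_gt0 -(repl repX).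
  rewrite -(qfZ FX _ _ c hc) -(qfZ FX (s2 *: emb v') _ c hc) -cE Q1 // Q2 //.
  by field; rewrite gt_eqF.
have hE : s1 = t' * s2.
  by have := congr1 (dotv (FX lX)) tE'; rewrite !dotvZ !(repfl repX) !mulr1.
move: tE'; rewrite scalerA -hE => /(scalerI (lt0r_neq0 s10)) /emb_inj E.
by rewrite E eqxx in ne.
Qed.

Lemma open_simplices : open_simplex X /\ open_simplex Y.
Proof.
have [j [e [He Hne]]] := vertex_frame.
(* The columns are the facet functionals, each scaled to be 1 on its own apex; they are dual to the
   apexes. *)
pose dual k (p : 'I_k -> 'rV[R]_n) : 'M[R]_(n + 1, k) :=
  \matrix_(a, i) (FY (j (p i)) 0 a / dotv (FY (j (p i))) (e (p i))).
have dualE k (p : 'I_k -> 'rV[R]_n) c i :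
    (c *m dual k p) 0 i = dotv (FY (j (p i))) c / dotv (FY (j (p i))) (e (p i)).
  rewrite mxE /dotv mulr_suml; apply: eq_bigr => a _.
  by rewrite mxE mulrA [c 0 a * _]mulrC.
have frame k (p : 'I_k -> 'rV[R]_n) : injective p -> (forall i, vertex (p i)) ->
    (\matrix_i e (p i)) *m dual k p = 1%:M.
  move=> inj Vp; apply/row_matrixP => i; rewrite row_mul rowK; apply/rowP => h.
  rewrite dualE row1 !mxE eqxx eq_sym /=; have [->|ne] := eqVneq i h.
    by rewrite divff // gt_eqF //; have [] := He _ (Vp h).
  by rewrite Hne ?mul0r // (inj_eq inj) eq_sym.
(* Duality makes the apexes independent, which bounds the number of vertices by [n + 1]. *)
have [k [p [inj Vp allp]]] := @bounded_enum _ vertex (n + 1)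
  (fun k (p : 'I_k -> 'rV[R]_n) inj Vp => mulmx1_min (frame k p inj Vp)).
have genX : forall c, ccone FX c ->
    exists a : 'I_k -> R, (forall i, 0 <= a i) /\ c = \sum_i a i *: emb (p i).
  pose P c := exists a : 'I_k -> R, (forall i, 0 <= a i) /\ c = \sum_i a i *: emb (p i).
  apply: (@ccone_ind _ _ _ FX lX P).
  - by move=> c; rewrite (repl repX); apply: (salient repX).
  - by exists (fun=> 0); split=> //; rewrite big1 // => i _; rewrite scale0r.
  - move=> _ _ [a [a0 ->]] [c [c0 ->]]; exists (fun i => a i + c i).
    split=> [i|]; first by rewrite addr_ge0.
    by rewrite -big_split; apply: eq_bigr => i _; rewrite scalerDl.
  - move=> t _ t0 [a [a0 ->]]; exists (fun i => t * a i).
    split=> [i|]; first by rewrite mulr_ge0.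
    by rewrite scaler_sumr; apply: eq_bigr => i _; rewrite scalerA.
  - move=> c /(extray_vertex repX) [h0 cE /allp [i pE]].
    exists (fun h => if h == i then height c else 0).
    split=> [h|]; first by case: ifP => // _; apply: ltW.
    rewrite (bigD1 i) //= eqxx big1 ?addr0 -?pE // => h /negbTE ->.
    by rewrite scale0r.
have kn : k = n.+1.
  apply/eqP; rewrite eqn_leq -addn1 (mulmx1_min (frame k p inj Vp)) /=.
  have : row_full (\matrix_i emb (p i)).
    by apply: (generators_row_full repX) => c /genX [a [_ ->]]; exists a.
  by move=> /eqP {1}<-; apply: rank_leq_row.
subst k; split.
  apply: (open_simplex_of_generators repX (p := p)) genX => i.
  by have [] := vertex_extray repX (Vp i).
have fe := frame _ p inj Vp.
have full : row_full (\matrix_i e (p i)).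
  have : row_free (\matrix_i e (p i)) by apply/row_freeP; exists (dual _ p).
  by rewrite /row_free /row_full => /eqP ->; rewrite addn1.
have ev i := extray_vertex repY (proj1 (He _ (Vp i))).
apply: (open_simplex_of_generators repY (p := fun i => dehom (e (p i)))).
  move=> i a; have [h0 eE _] := ev i; have [[Ke _ _] _] := He _ (Vp i).
  by have := Ke a; rewrite {1}eE dotvZ pmulr_rge0.
(* The apexes are a basis, and the coordinates of [c] are its values under the scaled facet
   functionals, hence nonnegative on the cone. *)
move=> c Kc; pose a i := (c *m dual _ p) 0 i.
exists (fun i => a i * height (e (p i))); split=> [i|].
  have [h0 _ _] := ev i; rewrite mulr_ge0 ?(ltW h0) // /a dualE divr_ge0 //.
  by rewrite ltW //; have [] := He _ (Vp i).
have /submxP [b cE] : (c <= \matrix_i e (p i))%MS by apply: submx_full.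
have -> : c = (c *m dual _ p) *m \matrix_i e (p i).
  by rewrite cE -(mulmxA b) fe mulmx1.
rewrite mulmx_sum_row; apply: eq_bigr => i _; rewrite rowK.
by have [_ eE _] := ev i; rewrite -scalerA -eE.
Qed.

End Apex.

Theorem theorem7p1 (R : realType) (n : nat) (X Y : set 'rV[R]_n) :
  (2 <= n)%N ->
  polyhedral_hilbert X -> polyhedral_hilbert Y ->
  forall (bX bY : 'rV[R]_n), X bX -> Y bY ->
  (exists g : 'rV[R]_n -> 'rV[R]_n,
     isometry_onto X Y g /\
     forall P, vertex_part X bX P -> facet_part Y bY (hatg X Y g bY @` P)) ->
  open_simplex X /\ open_simplex Y.
Proof.
move=> n2 /polyhedral_cone_rep [NX [FX [lX repX]]] /polyhedral_cone_rep [NY [FY [lY repY]]].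
move=> bX bY XbX YbY [g [isog vf]].
exact: (open_simplices repX repY isog XbX YbY (ltnW n2) vf).
Qed.
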